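(* Let $\mathcal{A}\in\mathbb{K}_l^{m\times r}$, $\mathcal{B}\in\mathbb{K}_l^{s\times n}$, $\mathcal{C}\in\mathbb{K}_l^{m\times n}$, let $\mathcal{M}\in\mathbb{K}_l^{r\times r}$ and $\mathcal{N}\in\mathbb{K}_l^{s\times s}$ be T-symmetric T-positive definite, let $\mathcal{S}_1,\dots,\mathcal{S}_{q_{\mathcal{S}}}\in\mathbb{K}_l^{m\times\tau}$, $\mathcal{V}_1,\dots,\mathcal{V}_{q_{\mathcal{V}}}\in\mathbb{K}_l^{n\times\zeta}$ be given sketching tubal matrices, and let $\mathbf{p}_{\mathcal{S}}\in\Delta_{q_{\mathcal{S}}}$, $\mathbf{p}_{\mathcal{V}}\in\Delta_{q_{\mathcal{V}}}$ be probability vectors. Let $$\mathcal{R}:=\mathbf{Range}\big(((\mathcal{N}^{-1})^{ST}*\mathcal{B}^{R})\otimes_t(\mathcal{M}^{-1}*\mathcal{A}^{T})\big).$$ Let $\mathcal{X}^{\star}$ satisfy $\mathcal{A}*\mathcal{X}^{\star}*\mathcal{B}=\mathcal{C}$. Let $\{\mathcal{X}^t\}_{t=0}^{\infty}$ be the iteration sequence calculated by the NTESP method with initial iteration $\mathcal{X}^0$ satisfying $\mathrm{vec}_t(\mathcal{X}^{0})\in\mathcal{R}$: at each step $t$, draw $i^t\sim\mathbf{p}_{\mathcal{S}}$ and $j^t\sim\mathbf{p}_{\mathcal{V}}$ (independently of the past and of each other), and set $$\mathcal{X}^{t+1}=\mathcal{X}^{t}-\mathcal{M}^{-1}*\mathcal{A}^{T}*\mathcal{E}_{i^t}*(\mathcal{A}*\mathcal{X}^{t}*\mathcal{B}-\mathcal{C})*\mathcal{G}_{j^t}*\mathcal{B}^{T}*\mathcal{N}^{-1}.$$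 Then $$\mathbb{E}[\|\mathcal{X}^{t}-\mathcal{X}^{\star}\|_{F(\mathcal{M},\mathcal{N})}^{2}\mid\mathcal{X}^{0}]\le\rho_{\text{NTESP}}^{\,t}\,\|\mathcal{X}^{0}-\mathcal{X}^{\star}\|_{F(\mathcal{M},\mathcal{N})}^{2},$$ where $$\rho_{\text{NTESP}}=1-\delta_{\mathbf{p}_{\mathcal{S}},\mathbf{p}_{\mathcal{V}}}^{2}=1-\lambda_{\min}\big(\mathbb{E}_{i\sim\mathbf{p}_{\mathcal{S}},\,j\sim\mathbf{p}_{\mathcal{V}}}[\mathrm{bcirc}(\mathcal{W}_j\otimes_t\mathcal{Z}_i)]\big)$$ and $$\delta_{\mathbf{p}_{\mathcal{S}},\mathbf{p}_{\mathcal{V}}}^{2}=\min_{0\neq\overrightarrow{\mathcal{Y}}\in\mathcal{R}}\frac{\|((\mathcal{N}^{\frac12})^{ST}\otimes_t\mathcal{M}^{\frac12})*\overrightarrow{\mathcal{Y}}\|^{2}_{\mathbb{E}_{j\sim\mathbf{p}_{\mathcal{V}}}[\mathcal{W}_j^{ST}]\otimes_t\mathbb{E}_{i\sim\mathbf{p}_{\mathcal{S}}}[\mathcal{Z}_i]}}{\|\overrightarrow{\mathcal{Y}}\|^{2}_{\mathcal{N}^{ST}\otimes_t\mathcal{M}}}.$$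
   Context: Fix $l\ge 1$. $\mathbb{K}_l^{m\times n}=\mathbb{R}^{m\times n\times l}$ (tubal matrices), $\mathbb{K}_l^{m}=\mathbb{K}_l^{m\times 1}$. $\mathcal{A}_{(k)}$ is the $k$-th frontal slice $\mathcal{A}(:,:,k)$. $\mathrm{unfold}(\mathcal{A})$ is the block column with blocks $\mathcal{A}_{(1)},\dots,\mathcal{A}_{(l)}$, $\mathrm{fold}$ is its inverse, and $\mathrm{bcirc}(\mathcal{A})$ is the block circulant matrix whose first block column is $\mathrm{unfold}(\mathcal{A})$ (block $(p,q)$ is $\mathcal{A}_{(((p-q)\bmod l)+1)}$). The t-product is $\mathcal{A}*\mathcal{B}=\mathrm{fold}(\mathrm{bcirc}(\mathcal{A})\,\mathrm{unfold}(\mathcal{B}))$. The identity $\mathcal{I}_n$ has first frontal slice the identity matrix and other slices zero; $\mathcal{A}^{-1}$ is the two-sided inverse with respect to $*$. Transpose: $(\mathcal{A}^{T})_{(1)}=\mathcal{A}_{(1)}^{T}$, $(\mathcal{A}^{T})_{(k)}=\mathcal{A}_{(l-k+2)}^{T}$ for $k\ge2$. Slice transpose: $(\mathcal{A}^{ST})_{(k)}=\mathcal{A}_{(k)}^{T}$ for all $k$. Reverse: $(\mathcal{A}^{R})_{(1)}=\mathcal{A}_{(1)}$, $(\mathcal{A}^{R})_{(k)}=\mathcal{A}_{(l-k+2)}$ for $k\ge2$. $\mathcal{A}^{\dag}$ is the unique Moore–Penrose inverse (the four Penrose equations with $*$ and ${}^T$). $\langle\cdot,\cdot\rangle$ is the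 entrywise inner product. $\mathcal{M}$ is T-symmetric if $\mathcal{M}=\mathcal{M}^{T}$, and T-symmetric T-positive (semi)definite if moreover $\langle\overrightarrow{\mathcal{X}},\mathcal{M}*\overrightarrow{\mathcal{X}}\rangle>0$ for all nonzero $\overrightarrow{\mathcal{X}}$ (resp. $\ge0$ for all $\overrightarrow{\mathcal{X}}$). $\mathcal{M}^{\frac12}$ is defined by $\mathrm{bcirc}(\mathcal{M}^{\frac12})=\mathrm{bcirc}(\mathcal{M})^{\frac12}$, and $\mathcal{M}^{-\frac12}=(\mathcal{M}^{\frac12})^{-1}$. $\mathrm{vec}_t(\mathcal{A})\in\mathbb{K}_l^{mn}$ stacks vertically the lateral slices $\mathcal{A}_{(:,1,:)},\dots,\mathcal{A}_{(:,n,:)}$. $\mathcal{A}\otimes_t\mathcal{B}$ is the block tubal matrix with $(i,j)$ block $\mathcal{A}_{(i,j,:)}*\mathcal{B}$ (the tube $\mathcal{A}_{(i,j,:)}\in\mathbb{K}_l^{1\times1}$ t-multiplied with every tube of $\mathcal{B}$). $\mathbf{Range}(\mathcal{A})=\{\mathcal{A}*\overrightarrow{\mathcal{X}}:\overrightarrow{\mathcal{X}}\in\mathbb{K}_l^{n}\}$. For T-symmetric T-positive semidefinite $\mathcal{D}$, $\|\overrightarrow{\mathcal{X}}\|_{\mathcal{D}}^2=\langle\mathcal{D}*\overrightarrow{\mathcal{X}},\overrightarrow{\mathcal{X}}\rangle$; and $\|\mathcal{X}\|_{F(\mathcal{M},\mathcal{N})}=\|\mathrm{vec}_t(\mathcal{X})\|_{\mathcal{N}^{ST}\otimes_t\mathcal{M}}$.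 $\lambda_{\min}$ is the smallest eigenvalue. $\Delta_q$ is the set of probability vectors in $\mathbb{R}^q$; $i\sim\mathbf{p}$ means $i$ is drawn with probability $p_i$. For $i\in\{1,\dots,q_{\mathcal{S}}\}$, $j\in\{1,\dots,q_{\mathcal{V}}\}$: $\mathcal{E}_i=\mathcal{S}_i*(\mathcal{S}_i^{T}*\mathcal{A}*\mathcal{M}^{-1}*\mathcal{A}^{T}*\mathcal{S}_i)^{\dag}*\mathcal{S}_i^{T}$, $\mathcal{G}_j=\mathcal{V}_j*(\mathcal{V}_j^{T}*\mathcal{B}^{T}*\mathcal{N}^{-1}*\mathcal{B}*\mathcal{V}_j)^{\dag}*\mathcal{V}_j^{T}$, $\mathcal{Z}_i=\mathcal{M}^{-\frac12}*\mathcal{A}^{T}*\mathcal{E}_i*\mathcal{A}*\mathcal{M}^{-\frac12}$, $\mathcal{W}_j=\mathcal{N}^{-\frac12}*\mathcal{B}*\mathcal{G}_j*\mathcal{B}^{T}*\mathcal{N}^{-\frac12}$.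
   Formalization: The bound with rate 1−δ² is stated only for X* with vec_t(X* ) in R (the bound with 1−λ_min holds for every solution X* ), and 1−δ² = 1−λ_min only if R is the whole space or δ² = 0; as printed both fail, e.g. l=1, A=(1 0), B=1, C=0, M, N identities, X⁰=0, X*=(0,5)^T. *)

(* Defs.v *)
From HB Require Import structures.
From mathcomp Require Import all_boot all_order all_algebra.
From mathcomp Require Import all_classical all_reals all_analysis.

Set Implicit Arguments.
Unset Strict Implicit.
Unset Printing Implicit Defensive.

Import Order.TTheory GRing.Theory Num.Theory.

Local Open Scope classical_set_scope.
Local Open Scope ring_scope.

(* A tubal matrix with tubes of length l.+1 (so that the length is always at
   least 1), given by its frontal slices.  Slices are numbered from 0 and their
   indices live in the additive group 'I_l.+1 of integers modulo l.+1: slice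
   number l-k+2 of the usual 1-based numbering is the slice of index - k, and
   index 0 is its own opposite. *)
Notation tubal R l m n := {ffun 'I_l.+1 -> 'M[R]_(m, n)}.

Section Tubal.
Context {R : realType} {l : nat}.

Definition unfold {m n} (A : tubal R l m n) : 'M[R]_(\sum_(k < l.+1) m, n) :=
  \mxcol_(k < l.+1) A k.

Definition fold {m n} (V : 'M[R]_(\sum_(k < l.+1) m, n)) : tubal R l m n :=
  [ffun k => submxcol V k].

Definition bcirc {m n} (A : tubal R l m n) :
    'M[R]_(\sum_(k < l.+1) m, \sum_(k < l.+1) n) :=
  \mxblock_(p < l.+1, q < l.+1) A (p - q).

Definition tmul {m n p} (A : tubal R l m n) (B : tubal R l n p) :
    tubal R l m p :=
  fold (bcirc A *m unfold B).

Definition tid n : tubal R l n n := [ffun k => if k == 0 then 1%:M else 0].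

Definition ttr {m n} (A : tubal R l m n) : tubal R l n m :=
  [ffun k => (A (- k))^T].

Definition tst {m n} (A : tubal R l m n) : tubal R l n m :=
  [ffun k => (A k)^T].

Definition trev {m n} (A : tubal R l m n) : tubal R l m n :=
  [ffun k => A (- k)].

End Tubal.

Notation "A ** B" := (tmul A B) (at level 40, left associativity) : ring_scope.

Section TubalTheory.
Context {R : realType} {l : nat}.

(* The two-sided inverse; 0 when there is none. *)
Definition tinv {n} (A : tubal R l n n) : tubal R l n n :=
  xget 0 [set X : tubal R l n n | A ** X = tid n /\ X ** A = tid n].

Definition tpinv {m n} (A : tubal R l m n) : tubal R l n m :=
  xget 0 [set X : tubal R l n m | [/\ A ** X ** A = A,
                                      X ** A ** X = X,
                                      ttr (A ** X) = A ** X &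
                                      ttr (X ** A) = X ** A]].

Definition tdot {m n} (X Y : tubal R l m n) : R :=
  \sum_(k < l.+1) \sum_(i < m) \sum_(j < n) X k i j * Y k i j.

Definition tsym_posdef {n} (M : tubal R l n n) : Prop :=
  ttr M = M /\ forall X : tubal R l n 1, X != 0 -> 0 < tdot X (M ** X).

Definition mx_psd {n} (P : 'M[R]_n) : Prop :=
  P^T = P /\ forall x : 'cV[R]_n, 0 <= (x^T *m P *m x) 0 0.

(* The square root meant is the unique one that is itself positive
   semidefinite. *)
Definition mx_sqrt {n} (P : 'M[R]_n) : 'M[R]_n :=
  xget 0 [set Q : 'M[R]_n | mx_psd Q /\ Q *m Q = P].

Definition tsqrt {n} (M : tubal R l n n) : tubal R l n n :=
  xget 0 [set X : tubal R l n n | bcirc X = mx_sqrt (bcirc M)].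

Definition tinvsqrt {n} (M : tubal R l n n) : tubal R l n n := tinv (tsqrt M).

Definition tube {m n} (A : tubal R l m n) (i : 'I_m) (j : 'I_n) :
    tubal R l 1 1 :=
  [ffun k => (A k i j)%:M].

Definition vect {m n} (A : tubal R l m n) : tubal R l (\sum_(j < n) m) 1 :=
  [ffun k => \mxcol_(j < n) col j (A k)].

(* Block (i, j) is the tube A_(i, j, :) t-multiplied with every tube of B. *)
Definition tkron {m n p q} (A : tubal R l m n) (B : tubal R l p q) :
    tubal R l (\sum_(i < m) p) (\sum_(j < n) q) :=
  [ffun k => \mxblock_(i < m, j < n)
     \matrix_(u < p, v < q) (tube A i j ** tube B u v) k 0 0].

Definition trange {m n} (A : tubal R l m n) : set (tubal R l m 1) :=
  [set A ** X | X in [set: tubal R l n 1]].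

(* This is the square ||X||_D^2; the seminorm itself is not needed. *)
Definition sqnorm {n} (D : tubal R l n n) (X : tubal R l n 1) : R :=
  tdot (D ** X) X.

(* This is the square ||X||_{F(M, N)}^2. *)
Definition sqnormF {r s} (M : tubal R l r r) (N : tubal R l s s)
    (X : tubal R l r s) : R :=
  sqnorm (tkron (tst N) M) (vect X).

End TubalTheory.

(* The least element of a set of reals; 0 when there is none. *)
Definition minimum {R : realType} (S : set R) : R :=
  xget 0 [set x | S x /\ forall y, S y -> x <= y].

Definition lambda_min {R : realType} {n} (P : 'M[R]_n) : R :=
  minimum [set a | eigenvalue P a].

Definition prob_vector {R : realType} {q} (p : 'I_q -> R) : Prop :=
  (forall i, 0 <= p i) /\ \sum_(i < q) p i = 1.

Definition mean {R : realType} {q} (p : 'I_q -> R) {V : lmodType R}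
    (f : 'I_q -> V) : V :=
  \sum_(i < q) p i *: f i.

Section NTESP.
Context {R : realType} {l m n r s tau zeta qS qV : nat}.
Variables (A : tubal R l m r) (B : tubal R l s n).
Variables (M : tubal R l r r) (N : tubal R l s s).
Variables (S : 'I_qS -> tubal R l m tau) (V : 'I_qV -> tubal R l n zeta).
Variables (pS : 'I_qS -> R) (pV : 'I_qV -> R).

Definition ntesp_E (i : 'I_qS) : tubal R l m m :=
  S i ** tpinv (ttr (S i) ** A ** tinv M ** ttr A ** S i) ** ttr (S i).

Definition ntesp_G (j : 'I_qV) : tubal R l n n :=
  V j ** tpinv (ttr (V j) ** ttr B ** tinv N ** B ** V j) ** ttr (V j).

Definition ntesp_Z (i : 'I_qS) : tubal R l r r :=
  tinvsqrt M ** ttr A ** ntesp_E i ** A ** tinvsqrt M.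

Definition ntesp_W (j : 'I_qV) : tubal R l s s :=
  tinvsqrt N ** B ** ntesp_G j ** ttr B ** tinvsqrt N.

Definition ntesp_range : set (tubal R l (\sum_(j < s) r) 1) :=
  trange (tkron (tst (tinv N) ** trev B) (tinv M ** ttr A)).

Definition ntesp_delta2 : R :=
  minimum [set sqnorm (tkron (mean pV (fun j => tst (ntesp_W j)))
                             (mean pS ntesp_Z))
                      (tkron (tst (tsqrt N)) (tsqrt M) ** Y)
               / sqnorm (tkron (tst N) M) Y
          | Y in [set Y | ntesp_range Y /\ Y <> 0]].

Definition ntesp_lambda : R :=
  lambda_min (mean pS (fun i => mean pV (fun j =>
    bcirc (tkron (ntesp_W j) (ntesp_Z i))))).

End NTESP.

Section Draws.
Context {d : measure_display} {T : measurableType d} {R : realType}.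
Variable P : probability T R.

Definition has_law {q} (p : 'I_q -> R) (X : T -> 'I_q) : Prop :=
  forall a, measurable (X @^-1` [set a]) /\ P (X @^-1` [set a]) = (p a)%:E.

(* The product rule is required over every finite subfamily ks and for every
   choice of one event in each of the classes F k, k in ks. *)
Definition mutually_independent {K : eqType} (F : K -> set (set T)) : Prop :=
  forall (ks : seq K) (E : K -> set T), uniq ks ->
    (forall k, k \in ks -> F k (E k)) ->
    P (\big[setI/setT]_(k <- ks) E k) = (\prod_(k <- ks) P (E k))%E.

Definition events_of {q} (X : T -> 'I_q) : set (set T) :=
  [set X @^-1` U | U in [set: set 'I_q]].

(* The single family indexed by nat + nat gathers all row draws and all column
   draws: each draw is independent of the past and of its companion. *)
Definition ntesp_draws {qS qV} (pS : 'I_qS -> R) (pV : 'I_qV -> R)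
    (is_ : nat -> T -> 'I_qS) (js_ : nat -> T -> 'I_qV) : Prop :=
  [/\ forall t, has_law pS (is_ t),
      forall t, has_law pV (js_ t) &
      mutually_independent (fun k : nat + nat =>
        match k with
        | inl t => events_of (is_ t)
        | inr t => events_of (js_ t)
        end)].

End Draws.

(* Main.v *)
(** Measured by D = M^(1/2) * (X - Xstar) * N^(1/2), the error evolves as
    D' = D - Z_i * D * W_j, where Z_i and W_j are orthogonal projectors for the
    t-product.  Hence |D'|^2 = |D|^2 - <Z_i * D * W_j, D>, and by independence
    the mean of |D|^2 decreases at each step by the energy
    <E[Z] * D * E[W], D>, a quadratic form bounded below by lambda_min |D|^2 in
    general and by delta^2 |D|^2 for errors in the range.  Since bcirc is an
    injective morphism of algebras with transposition, all the spectral facts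
    needed (inverses, square roots, Moore-Penrose inverses, attained Rayleigh
    quotients) reduce to real symmetric matrices and polynomials in them.  The
    energy belongs to W^ST (x) Z whereas lambda_min is taken for W (x) Z; the
    two have the same annihilating polynomials, hence the same eigenvalues. *)
Require Import Defs.
From HB Require Import structures.
From mathcomp Require Import all_boot all_order all_algebra.
From mathcomp Require Import all_classical all_reals all_analysis.
From mathcomp Require Import ring lra.

Set Implicit Arguments.
Unset Strict Implicit.
Unset Printing Implicit Defensive.

Import Order.TTheory GRing.Theory Num.Theory.

Local Open Scope classical_set_scope.
Local Open Scope ring_scope.

(** * Quadratic forms and polynomials of real symmetric matrices *)

(** The two rates are minima of one quotient, [energy (scaled X)] over [sqnormF M N X]: [lambda]
    over all nonzero errors, [delta2] over the nonzero errors in the range. Hence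
    [0 <= lambda <= delta2] once the range is nonzero, with equality when the range is everything or
    [delta2 = 0]. An error stays in the range exactly when it starts there, which ties the rate with
    [delta2] to [Xstar] lying in the range as [X0] does. Matrix sizes may be zero and the range may
    be trivial; [minimum] then returns its default 0, and these cases are argued apart. No
    diagonalisation enters: eigenvectors come from an infimum of quotients, and functions of a
    symmetric matrix from polynomials interpolating them on its eigenvalues. *)

Section QuadraticForms.
Context {R : realType}.

(** Row vectors, because [eigenvalue] and row spaces act on the left. *)
Definition bform {n} (H : 'M[R]_n) (x y : 'rV[R]_n) : R :=
  (x *m H *m y^T) 0 0.

Lemma bformDl n (H : 'M[R]_n) x1 x2 y :
  bform H (x1 + x2) y = bform H x1 y + bform H x2 y.
Proof. by rewrite /bform !mulmxDl mxE. Qed.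

Lemma bformZl n (H : 'M[R]_n) a x y : bform H (a *: x) y = a * bform H x y.
Proof. by rewrite /bform -!scalemxAl mxE. Qed.

Lemma bformDr n (H : 'M[R]_n) x y1 y2 :
  bform H x (y1 + y2) = bform H x y1 + bform H x y2.
Proof. by rewrite /bform linearD /= !mulmxDr mxE. Qed.

Lemma bformZr n (H : 'M[R]_n) a x y : bform H x (a *: y) = a * bform H x y.
Proof. by rewrite /bform linearZ /= -!scalemxAr mxE. Qed.

Lemma bformC n (H : 'M[R]_n) x y : H^T = H -> bform H x y = bform H y x.
Proof.
move=> hH; rewrite /bform.
have -> : y *m H *m x^T = (x *m H *m y^T)^T
  by rewrite !trmx_mul hH trmxK mulmxA.
by rewrite [in RHS]mxE.
Qed.

Lemma bformB n (H G : 'M[R]_n) a x y :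
  bform (H - a *: G) x y = bform H x y - a * bform G x y.
Proof.
by rewrite /bform mulmxBr mulmxBl -scalemxAr -scalemxAl !mxE.
Qed.

Lemma bform1E n (x : 'rV[R]_n) : bform 1%:M x x = \sum_i x 0 i ^+ 2.
Proof.
by rewrite /bform mulmx1 mxE; apply: eq_bigr => i _; rewrite mxE.
Qed.

Lemma bform1_ge0 n (x : 'rV[R]_n) : 0 <= bform 1%:M x x.
Proof. by rewrite bform1E sumr_ge0 // => i _; rewrite sqr_ge0. Qed.

Lemma bform1_eq0 n (x : 'rV[R]_n) : (bform 1%:M x x == 0) = (x == 0).
Proof.
apply/idP/eqP => [|->]; last by rewrite /bform !mul0mx mxE.
rewrite bform1E psumr_eq0 => [/allP h|i _]; last exact: sqr_ge0.
apply/rowP => i; rewrite mxE; apply/eqP.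
have /implyP := h i (mem_index_enum i); rewrite expf_eq0 /=; exact.
Qed.

Lemma bform_bounded n (H : 'M[R]_n) :
  exists2 c : R, 0 < c & forall x, `|bform H x x| <= c * bform 1%:M x x.
Proof.
(* The sum of the moduli of the entries already bounds the form; the 1 makes the constant
   positive. *)
exists (1 + \sum_i \sum_j `|H j i|).
  by rewrite ltr_pwDl // sumr_ge0 // => i _; rewrite sumr_ge0.
move=> x; rewrite mulrDl mul1r.
suff: `|bform H x x| <= (\sum_i \sum_j `|H j i|) * bform 1%:M x x.
  by move/le_trans; apply; rewrite lerDr bform1_ge0.
have le1 (i : 'I_n) : x 0 i ^+ 2 <= bform 1%:M x x.
  rewrite bform1E (bigD1 i) //= lerDl sumr_ge0 // => j _; exact: sqr_ge0.
rewrite /bform mxE mulr_suml (le_trans (ler_norm_sum _ _ _)) // ler_sum // => i _.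
rewrite mxE normrM !mulr_suml (le_trans (ler_wpM2r _ (ler_norm_sum _ _ _))) //.
rewrite mulr_suml ler_sum // => j _.
rewrite mxE normrM [_ * `|H _ _|]mulrC -mulrA ler_wpM2l // -/(bform _ _ _).
have := le1 i; have := le1 j.
rewrite -(real_normK (num_real (x 0 i))) -(real_normK (num_real (x 0 j))).
have := sqr_ge0 (`|x 0 j| - `|x 0 i|).
move: (bform _ _ _) `|_| `|_| => c a b; nra.
Qed.

Lemma bform_CauchySchwarz n (H : 'M[R]_n) x y : H^T = H ->
  (forall z, 0 <= bform H z z) ->
  bform H x y ^+ 2 <= bform H x x * bform H y y.
Proof.
move=> hs hp.
have key u v : 0 <= u ^+ 2 * bform H x x + 2 * u * v * bform H x y
                    + v ^+ 2 * bform H y y.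
  have := hp (u *: x + v *: y).
  rewrite bformDl !bformDr !bformZl !bformZr (bformC y x) //.
  by move/le_trans; apply; rewrite le_eqVlt; apply/orP; left; apply/eqP; ring.
have := hp x; have := hp y.
move: (bform H x x) (bform H x y) (bform H y y) key => a b c key hc ha.
have [c0|c0] := eqVneq c 0.
  have [->|b0] := eqVneq b 0; first by rewrite c0 mulr0 expr0n.
  (* With [c = 0] the form is affine in its second coefficient, and this choice gives it the value
     [- a - 2 < 0]. *)
  have := key 1 (- (a + 1) / b); rewrite c0 mulr0 addr0 expr1n mul1r.
  have -> : 2 * 1 * (- (a + 1) / b) * b = - (2 * (a + 1)) by field.
  lra.
have cp : 0 < c by rewrite lt_def c0.
rewrite -(ler_pM2l cp).
(* The minimiser [(c, - b)], where the form equals [c * (a * c - b ^+ 2)]. *)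
have := key c (- b); nra.
Qed.

Lemma nonunit_kernel n (H : 'M[R]_n) : H \notin unitmx ->
  exists2 x : 'rV_n, x != 0 & x *m H = 0.
Proof.
rewrite -row_free_unit -kermx_eq0 => /rowV0Pn[x /sub_kermxP xH x0].
by exists x.
Qed.

(** Cauchy-Schwarz against [y := x *m invmx H]: [H(y, x)] is the squared norm of [x], while
    [H(y, y)] is the form of [invmx H] at [x], at most [c] times that squared norm. One factor
    cancels, which replaces a compactness argument. *)
Lemma bform_coercive n (H : 'M[R]_n) : H^T = H ->
  (forall x, 0 <= bform H x x) -> H \in unitmx ->
  exists2 c : R, 0 < c & forall x, bform 1%:M x x <= c * bform H x x.
Proof.
move=> hs hp hu; have [c c0 hc] := bform_bounded (invmx H).
exists c => // x; set y := x *m invmx H.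
have [x0|x0] := eqVneq (bform 1%:M x x) 0.
  by rewrite x0 mulr_ge0 // ltW.
have xp : 0 < bform 1%:M x x by rewrite lt_def x0 bform1_ge0.
have e1 : bform H y x = bform 1%:M x x by rewrite /bform /y mulmxKV // mulmx1.
have e2 : bform H y y = bform (invmx H) x x.
  by rewrite /bform /y mulmxKV // trmx_mul trmx_inv hs mulmxA.
have := bform_CauchySchwarz y x hs hp; rewrite e1 e2 => h.
rewrite -(ler_pM2l xp) -expr2 (le_trans h) // mulrA ler_wpM2r //.
by rewrite [leRHS]mulrC (le_trans _ (hc x)) // ler_norm.
Qed.

Lemma posdef_unit n (G : 'M[R]_n) :
  (forall x, x != 0 -> 0 < bform G x x) -> G \in unitmx.
Proof.
move=> hG; apply/negPn/negP => /nonunit_kernel[x x0 xG].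
by have := hG x x0; rewrite /bform xG mul0mx mxE ltxx.
Qed.

(* The infimum mu of the quotient is an eigenvalue: otherwise H - mu G would be
   positive definite, hence coercive, and mu could be increased. *)
Lemma generalized_eigenvector n (H G : 'M[R]_n) : (0 < n)%N ->
  H^T = H -> G^T = G -> (forall x, x != 0 -> 0 < bform G x x) ->
  exists (mu : R) (x : 'rV_n), [/\ x != 0, x *m H = mu *: (x *m G) &
    forall y, mu * bform G y y <= bform H y y].
Proof.
move=> n0 hH hG pG.
have pG' x : 0 <= bform G x x.
  have [->|/pG/ltW//] := eqVneq x 0.
  by rewrite /bform !mul0mx mxE.
have [cG cG0 hcG] := bform_coercive hG pG' (posdef_unit pG).
have [cG' cG'0 hcG'] := bform_bounded G.
have [cH cH0 hcH] := bform_bounded H.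
pose E := [set a : R | exists2 x, x != 0 & a = bform H x x / bform G x x].
have lbE : lbound E (- (cH * cG)).
  move=> _ [x x0 ->]; rewrite ler_pdivlMr ?pG // mulNr lerNl.
  apply: le_trans (ler_norm _) _; rewrite normrN (le_trans (hcH x)) // -mulrA.
  by rewrite ler_wpM2l ?hcG // ltW.
have neE : E !=set0.
  exists (bform H (const_mx 1) (const_mx 1) / bform G (const_mx 1) (const_mx 1)).
  exists (const_mx 1) => //; apply/eqP => /rowP/(_ (Ordinal n0)).
  by rewrite !mxE => /eqP; rewrite oner_eq0.
pose mu := inf E.
have hmu y : mu * bform G y y <= bform H y y.
  have [->|y0] := eqVneq y 0; first by rewrite /bform !mul0mx mxE mulr0.
  rewrite -ler_pdivlMr ?pG //; apply: ge_inf; first by exists (- (cH * cG)).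
  by exists y.
pose Q := H - mu *: G.
have hQ : Q^T = Q by rewrite /Q linearB /= linearZ /= hH hG.
have pQ x : 0 <= bform Q x x by rewrite bformB subr_ge0.
have [uQ|] := boolP (Q \in unitmx); last first.
  move=> /nonunit_kernel[x x0 /eqP]; rewrite mulmxBr subr_eq0 -scalemxAr.
  by move/eqP => xQ; exists mu, x.
have [c c0 hc] := bform_coercive hQ pQ uQ.
(* The possible increase: [Q(x, x)] is at least the squared norm over [c], and the squared norm at
   least [G(x, x)] over [cG']. *)
suff : mu + (c * cG')^-1 <= mu.
  by rewrite gerDl leNgt invr_gt0 mulr_gt0.
apply: lb_le_inf => // _ [x x0 ->]; rewrite ler_pdivlMr ?pG // mulrDl.
rewrite -lerBrDl -bformB -/Q mulrC ler_pdivrMr ?mulr_gt0 //.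
rewrite mulrA mulrC (le_trans (le_trans (ler_norm _) (hcG' x))) //.
rewrite ler_wpM2l ?(ltW cG'0) //.
by rewrite mulrC.
Qed.

Lemma bform_conj m n (K : 'M[R]_(m, n)) (H : 'M[R]_n) x y :
  bform (K *m H *m K^T) x y = bform H (x *m K) (y *m K).
Proof. by rewrite /bform trmx_mul !mulmxA. Qed.

(** Conjugating by a row basis of [K] restricts both forms to its row space. As [H] need not
    preserve that space, the eigenvector equation survives only when tested against vectors of the
    space. *)
Lemma rayleigh_subspace m n (K : 'M[R]_(m, n)) (H G : 'M[R]_n) :
  K != 0 -> H^T = H -> G^T = G -> (forall x, x != 0 -> 0 < bform G x x) ->
  exists (mu : R) (x : 'rV_n), [/\ x != 0, (x <= K)%MS,
    forall y, (y <= K)%MS -> bform H x y = mu * bform G x y &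
    forall y, (y <= K)%MS -> mu * bform G y y <= bform H y y].
Proof.
move=> K0 hH hG pG; pose B := row_base K.
have B0 : (0 < \rank K)%N by rewrite lt0n mxrank_eq0.
have Bf : row_free B by exact: row_base_free.
have eB : (B :=: K)%MS by exact: eq_row_base.
clearbody B.
have inB (y : 'rV_n) : (y <= K)%MS -> exists z, y = z *m B.
  move=> yK; have /submxP[z ->] : (y <= B)%MS by rewrite eB.
  by exists z.
have sB (z : 'rV_(\rank K)) : (z *m B <= K)%MS 
  by rewrite -eB submxMl.
have sym (L : 'M[R]_n) : L^T = L -> (B *m L *m B^T)^T = B *m L *m B^T.
  by move=> hL; rewrite !trmx_mul trmxK hL mulmxA.
have [|mu [x [x0 xe hx]]] :=
  generalized_eigenvector B0 (sym _ hH) (sym _ hG).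
  by move=> z z0; rewrite bform_conj pG // mulmx_free_eq0.
have e z : bform H (x *m B) (z *m B) = mu * bform G (x *m B) (z *m B).
  by rewrite -!bform_conj /bform xe -scalemxAl mxE.
exists mu, (x *m B); split; [by rewrite mulmx_free_eq0|exact: sB| |].
  by move=> y /inB[z ->]; rewrite e.
by move=> y /inB[z ->]; rewrite -!bform_conj.
Qed.

End QuadraticForms.

(** * Polynomials in a symmetric matrix and their values on its eigenvalues *)

Section MatrixPolynomials.
Context {R : realType}.

(* Unlike [horner_mx], this makes sense in every dimension, such as the sums of
   block sizes below, not only for dimensions of the form n.+1. *)
Definition mxeval {n} (p : {poly R}) (P : 'M[R]_n) : 'M[R]_n :=
  \sum_(k < size p) p`_k *: P ^+ k.

Lemma mxevalE n (p : {poly R}) (P : 'M[R]_n.+1) : mxeval p P = horner_mx P p.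
Proof.
rewrite /mxeval -[in RHS](coefK p) poly_def linear_sum; apply: eq_bigr => k _.
by rewrite linearZ /= rmorphXn /= horner_mx_X.
Qed.

Lemma mxevalB n (p q : {poly R}) (P : 'M[R]_n) :
  mxeval (p - q) P = mxeval p P - mxeval q P.
Proof.
case: n P => [P|n P]; first by rewrite [LHS]thinmx0 [RHS]thinmx0.
by rewrite !mxevalE raddfB.
Qed.

Lemma mxevalM n (p q : {poly R}) (P : 'M[R]_n) :
  mxeval (p * q) P = mxeval p P *m mxeval q P.
Proof.
case: n P => [P|n P]; first by rewrite [LHS]thinmx0 [RHS]thinmx0.
by rewrite !mxevalE rmorphM.
Qed.

Lemma mxeval1 n (P : 'M[R]_n) : mxeval 1 P = 1%:M.
Proof.
case: n P => [P|n P]; first by rewrite [LHS]thinmx0 [RHS]thinmx0.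
by rewrite !mxevalE rmorph1.
Qed.

Lemma mxevalX n (P : 'M[R]_n) : mxeval 'X P = P.
Proof.
case: n P => [P|n P]; first by rewrite [LHS]thinmx0 [RHS]thinmx0.
by rewrite !mxevalE horner_mx_X.
Qed.

Lemma mxeval_comp_sqr n (p : {poly R}) (P : 'M[R]_n) :
  mxeval (p \Po 'X^2) P = mxeval p (P *m P).
Proof.
case: n P => [P|n P]; first by rewrite [LHS]thinmx0 [RHS]thinmx0.
rewrite mxevalE comp_polyE linear_sum; apply: eq_bigr => k _.
by rewrite linearZ /= !rmorphXn /= horner_mx_X expr2.
Qed.

Lemma trmxX n (P : 'M[R]_n) k : P^T = P -> (P ^+ k)^T = P ^+ k.
Proof.
move=> hP; elim: k => [|k IH]; first by rewrite !expr0 trmx1.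
by rewrite exprS [LHS]trmx_mul hP IH -[LHS]/(P ^+ k * P) -exprSr exprS.
Qed.

Lemma mxeval_sym n (p : {poly R}) (P : 'M[R]_n) :
  P^T = P -> (mxeval p P)^T = mxeval p P.
Proof.
move=> hP; rewrite /mxeval linear_sum; apply: eq_bigr => k _.
by rewrite linearZ /= trmxX.
Qed.

Lemma mxeval_comm n (p : {poly R}) (P : 'M[R]_n) :
  P *m mxeval p P = mxeval p P *m P.
Proof. by rewrite -{1 4}(mxevalX P) -!mxevalM mulrC. Qed.

Lemma mxeval_eigenvector n (p : {poly R}) (P : 'M[R]_n) (a : R) (x : 'rV_n) :
  x *m P = a *: x -> x *m mxeval p P = p.[a] *: x.
Proof.
move=> xP; rewrite /mxeval mulmx_sumr horner_coef scaler_suml.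
apply: eq_bigr => k _; rewrite -scalemxAr -scalerA; congr (_ *: _).
elim: (nat_of_ord k) => [|j IH]; first by rewrite !expr0 scale1r [LHS]mulmx1.
by rewrite !exprSr -[_ * P]/(_ *m P) mulmxA IH -scalemxAl xP scalerA.
Qed.

(** The polynomial need not split over the reals, so only its real roots are listed, each once;
    linear factors are split off by induction on the degree. *)
Lemma poly_root_list (p : {poly R}) : p != 0 ->
  exists s, uniq s /\ forall a, (a \in s) = root p a.
Proof.
have [n] := ubnP (size p); elim: n p => // n IH p szp p0.
have [[a ra]|nor] := pselect (exists a, root p a); last first.
  exists [::]; split => // a; rewrite in_nil; apply/esym/negbTE/negP => ra.
  by apply: nor; exists a.
have /factor_theorem[q pq] := ra.
have q0 : q != 0 by apply: contra p0 => /eqP q0; rewrite pq q0 mul0r.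
have [|s [us hs]] := IH q _ q0.
  by move: szp; rewrite pq size_Mmonic ?monicXsubC // size_XsubC addn2.
exists (undup (a :: s)); split; first exact: undup_uniq.
by move=> b; rewrite mem_undup inE hs pq rootM root_XsubC orbC.
Qed.

(** Newton interpolation: a new node is corrected by a multiple of the product [q] that vanishes at
    the earlier ones. *)
Lemma interpolation (s : seq R) (f : R -> R) :
  exists p : {poly R}, forall a, a \in s -> p.[a] = f a.
Proof.
elim: s => [|a s [p hp]]; first by exists 0.
have [as_|nas] := boolP (a \in s).
  by exists p => b; rewrite inE => /predU1P[->|]; apply: hp.
pose q := \prod_(b <- s) ('X - b%:P).
have qa : q.[a] != 0 by rewrite -[_ == _]/(root q a) root_prod_XsubC.
exists (p + ((f a - p.[a]) / q.[a]) *: q) => b.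
rewrite inE hornerD hornerZ => /predU1P[->|bs].
  by rewrite divfK // addrC subrK.
have /rootP-> : root q b by rewrite root_prod_XsubC.
by rewrite mulr0 addr0 hp.
Qed.

(* If the product K of the (P - a) over the eigenvalues a did not vanish, P
   would have an eigenvector in the row space of K, which K annihilates. *)
Lemma sym_spectrum n (P : 'M[R]_n) : P^T = P ->
  exists2 s : seq R, (forall a, a \in s -> eigenvalue P a) &
    forall p q, {in s, forall a, p.[a] = q.[a]} -> mxeval p P = mxeval q P.
Proof.
case: n P => [P _|n P hP].
  by exists [::] => // p q _; rewrite [LHS]thinmx0 [RHS]thinmx0.
have [s [us hs]] := poly_root_list (monic_neq0 (char_poly_monic P)).
exists s; first by move=> a; rewrite hs eigenvalue_root_char.
pose g := \prod_(a <- s) ('X - a%:P).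
suff g0 : mxeval g P = 0.
  move=> p q pq; apply/eqP; rewrite -subr_eq0 -mxevalB.
  have /dvdpP[h ->] : g %| p - q.
    apply: uniq_roots_dvdp; rewrite ?uniq_rootsE //; apply/allP => a /pq e.
    by rewrite rootE hornerD hornerN e subrr.
  by rewrite mxevalM g0 mulmx0.
apply/eqP/negPn/negP => K0.
have [|mu [x [x0 /submxP[z xz] hx _]]] := rayleigh_subspace K0 hP (trmx1 _ _).
  by move=> x x0; rewrite lt_def bform1_eq0 x0 bform1_ge0.
pose y := x *m P - mu *: x.
(* The residual [y] stays in the row space because [P] commutes with polynomials in [P]; it can
   therefore serve as its own test vector, which gives it norm zero. *)
have yK : (y <= mxeval g P)%MS.
  rewrite /y xz addmx_sub //.
    by rewrite -mulmxA -mxeval_comm mulmxA submxMl.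
  by rewrite -scaleNr scalemx_sub // submxMl.
have xP : x *m P = mu *: x.
  apply/eqP; rewrite -subr_eq0 -bform1_eq0 -/y {1}/y -scaleNr bformDl bformZl.
  by rewrite mulNr -(hx _ yK) /bform mulmx1 subrr.
have mus : mu \in s.
  by rewrite hs -eigenvalue_root_char; apply/eigenvalueP; exists x.
have gmu : g.[mu] = 0 by apply/rootP; rewrite root_prod_XsubC.
move: x0; rewrite -bform1_eq0 {2}xz /bform mulmx1 trmx_mul mxeval_sym // mulmxA.
by rewrite (mxeval_eigenvector _ xP) gmu scale0r mul0mx mxE eqxx.
Qed.

(** The minimal polynomial of [P] annihilates [P'], so it vanishes at every eigenvalue of [P'], and
    its roots are the eigenvalues of [P]. *)
Lemma eigenvalue_transfer n (P P' : 'M[R]_n) a :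
  (forall p, mxeval p P = 0 -> mxeval p P' = 0) ->
  eigenvalue P' a -> eigenvalue P a.
Proof.
case: n P P' => [P P' _|n P P' h] /eigenvalueP[x xP x0].
  by rewrite thinmx0 eqxx in x0.
have /h : mxeval (mxminpoly P) P = 0 by rewrite mxevalE mx_root_minpoly.
rewrite eigenvalue_root_min rootE => e.
have := mxeval_eigenvector (mxminpoly P) xP; rewrite e mulmx0 => /esym/eqP.
by rewrite scaler_eq0 (negPf x0) orbF.
Qed.

Lemma psd_eigenvalue_ge0 n (P : 'M[R]_n) a :
  (forall x, 0 <= bform P x x) -> eigenvalue P a -> 0 <= a.
Proof.
move=> hP /eigenvalueP[x xP x0].
have := hP x; rewrite /bform xP -scalemxAl mxE pmulr_lge0 //.
have := bform1_ge0 x; rewrite le_eqVlt eq_sym bform1_eq0 (negPf x0) /=.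
by rewrite /bform mulmx1.
Qed.

End MatrixPolynomials.

(** * Tubal matrices *)

Section TubalAlgebra.
Context {R : realType} {l : nat}.

Lemma tmulE m n p (A : tubal R l m n) (B : tubal R l n p) k :
  (A ** B) k = \sum_q A (k - q) *m B q.
Proof. by rewrite ffunE /bcirc /unfold mul_mxblock_mxrow mxcolK. Qed.

Lemma tmulA m n p q (A : tubal R l m n) (B : tubal R l n p) (C : tubal R l p q) :
  A ** (B ** C) = A ** B ** C.
Proof.
apply/ffunP => k; rewrite !tmulE.
under eq_bigr => i _ do rewrite tmulE mulmx_sumr.
under [RHS]eq_bigr => i _ do rewrite tmulE mulmx_suml.
rewrite exchange_big; apply: eq_bigr => j _ /=.
rewrite (reindex_inj (addIr j)) /=; apply: eq_bigr => i _.
by rewrite mulmxA addrK opprD addrCA addrC.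
Qed.

Lemma tmulDl m n p (A B : tubal R l m n) (C : tubal R l n p) :
  (A + B) ** C = A ** C + B ** C.
Proof.
apply/ffunP => k; rewrite [RHS]ffunE !tmulE -big_split; apply: eq_bigr => i _ /=.
by rewrite ffunE mulmxDl.
Qed.

Lemma tmulDr m n p (A : tubal R l m n) (B C : tubal R l n p) :
  A ** (B + C) = A ** B + A ** C.
Proof.
apply/ffunP => k; rewrite [RHS]ffunE !tmulE -big_split; apply: eq_bigr => i _ /=.
by rewrite ffunE mulmxDr.
Qed.

Lemma tmulZl m n p (a : R) (A : tubal R l m n) (B : tubal R l n p) :
  (a *: A) ** B = a *: (A ** B).
Proof.
apply/ffunP => k; rewrite [RHS]ffunE !tmulE scaler_sumr; apply: eq_bigr => i _ /=.
by rewrite ffunE scalemxAl.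
Qed.

Lemma tmulZr m n p (a : R) (A : tubal R l m n) (B : tubal R l n p) :
  A ** (a *: B) = a *: (A ** B).
Proof.
apply/ffunP => k; rewrite [RHS]ffunE !tmulE scaler_sumr; apply: eq_bigr => i _ /=.
by rewrite ffunE scalemxAr.
Qed.

Lemma tmulNl m n p (A : tubal R l m n) (B : tubal R l n p) :
  (- A) ** B = - (A ** B).
Proof. by rewrite -(scaleN1r A) tmulZl scaleN1r. Qed.

Lemma tmulNr m n p (A : tubal R l m n) (B : tubal R l n p) :
  A ** (- B) = - (A ** B).
Proof. by rewrite -(scaleN1r B) tmulZr scaleN1r. Qed.

Lemma tmul0l m n p (B : tubal R l n p) : (0 : tubal R l m n) ** B = 0.
Proof. by have := tmulZl 0 (0 : tubal R l m n) B; rewrite !scale0r. Qed.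

Lemma tmul0r m n p (A : tubal R l m n) : A ** (0 : tubal R l n p) = 0.
Proof. by have := tmulZr 0 A (0 : tubal R l n p); rewrite !scale0r. Qed.

Lemma tmul_suml m n p (I : finType) (A : I -> tubal R l m n) (B : tubal R l n p) :
  (\sum_i A i) ** B = \sum_i A i ** B.
Proof.
by apply: (big_morph (fun A => A ** B)) => [x y|]; rewrite ?tmulDl ?tmul0l.
Qed.

Lemma tmul_sumr m n p (I : finType) (A : tubal R l m n) (B : I -> tubal R l n p) :
  A ** (\sum_i B i) = \sum_i A ** B i.
Proof. by apply: big_morph => [x y|]; rewrite ?tmulDr ?tmul0r. Qed.

Lemma tmul1l n m (A : tubal R l n m) : tid n ** A = A.
Proof.
apply/ffunP => k; rewrite tmulE (bigD1 k) //= subrr ffunE eqxx mul1mx big1.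
  by rewrite addr0.
by move=> i ik; rewrite ffunE subr_eq0 eq_sym (negPf ik) mul0mx.
Qed.

Lemma tmul1r n m (A : tubal R l m n) : A ** tid n = A.
Proof.
apply/ffunP => k; rewrite tmulE (bigD1 0) //= subr0 ffunE eqxx mulmx1 big1.
  by rewrite addr0.
by move=> i i0; rewrite ffunE (negPf i0) mulmx0.
Qed.

Lemma ttrK m n (A : tubal R l m n) : ttr (ttr A) = A.
Proof. by apply/ffunP => k; rewrite !ffunE opprK trmxK. Qed.

Lemma ttrM m n p (A : tubal R l m n) (B : tubal R l n p) :
  ttr (A ** B) = ttr B ** ttr A.
Proof.
apply/ffunP => k; rewrite [LHS]ffunE !tmulE linear_sum /=.
rewrite (reindex_inj (addIr (- k))) /=; apply: eq_bigr => i _.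
by rewrite trmx_mul !ffunE !opprB addKr.
Qed.

Lemma ttrD m n (A B : tubal R l m n) : ttr (A + B) = ttr A + ttr B.
Proof. by apply/ffunP => k; rewrite !ffunE linearD. Qed.

Lemma ttrZ m n (a : R) (A : tubal R l m n) : ttr (a *: A) = a *: ttr A.
Proof. by apply/ffunP => k; rewrite !ffunE linearZ. Qed.

Lemma ttr0 m n : ttr (0 : tubal R l m n) = 0.
Proof. by apply/ffunP => k; rewrite !ffunE linear0. Qed.

Lemma ttr_sum m n (I : finType) (A : I -> tubal R l m n) :
  ttr (\sum_i A i) = \sum_i ttr (A i).
Proof. by apply: big_morph => [x y|]; rewrite ?ttrD ?ttr0. Qed.

Lemma ttr1 n : ttr (tid n : tubal R l n n) = tid n.
Proof.
apply/ffunP => k; rewrite !ffunE oppr_eq0; case: ifP => _; first exact: trmx1.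
exact: trmx0.
Qed.

Lemma tstK m n (A : tubal R l m n) : tst (tst A) = A.
Proof. by apply/ffunP => k; rewrite !ffunE trmxK. Qed.

Lemma tstM m n p (A : tubal R l m n) (B : tubal R l n p) :
  tst (A ** B) = tst B ** tst A.
Proof.
apply/ffunP => k; rewrite [LHS]ffunE !tmulE linear_sum /=.
rewrite (reindex_inj (can_inj (subKr k))) /=; apply: eq_bigr => i _.
by rewrite trmx_mul !ffunE subKr.
Qed.

Lemma tst_mean m n q (p : 'I_q -> R) (f : 'I_q -> tubal R l m n) :
  mean p (fun i => tst (f i)) = tst (mean p f).
Proof.
apply/ffunP => k; rewrite ffunE !sum_ffunE linear_sum; apply: eq_bigr => i _ /=.
by rewrite !ffunE linearZ.
Qed.

Lemma tst1 n : tst (tid n : tubal R l n n) = tid n.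
Proof.
apply/ffunP => k; rewrite !ffunE; case: ifP => _; first exact: trmx1.
exact: trmx0.
Qed.

Lemma trev_tst m n (A : tubal R l m n) : trev A = tst (ttr A).
Proof. by apply/ffunP => k; rewrite !ffunE trmxK. Qed.

Lemma bcircM m n p (A : tubal R l m n) (B : tubal R l n p) :
  bcirc (A ** B) = bcirc A *m bcirc B.
Proof.
rewrite /bcirc mul_mxblock; apply: eq_mxblock => i j.
rewrite tmulE (reindex_inj (addIr (- j))) /=; apply: eq_bigr => k _.
by rewrite opprB addrA subrK.
Qed.

Lemma bcirc_inj m n : injective (@bcirc R l m n).
Proof.
move=> A B h; apply/ffunP => k.
by have := congr1 (fun U => submxblock U k 0) h; rewrite /bcirc !mxblockK subr0.
Qed.

Lemma bcircZ m n (a : R) (A : tubal R l m n) : bcirc (a *: A) = a *: bcirc A.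
Proof. by apply/matrixP => i j; rewrite !mxE ffunE mxE. Qed.

Lemma bcircD m n (A B : tubal R l m n) : bcirc (A + B) = bcirc A + bcirc B.
Proof. by apply/matrixP => i j; rewrite !mxE ffunE mxE. Qed.

Lemma bcirc0 m n : bcirc (0 : tubal R l m n) = 0.
Proof. by apply/matrixP => i j; rewrite !mxE ffunE mxE. Qed.

Lemma bcirc_sum m n (I : finType) (A : I -> tubal R l m n) :
  bcirc (\sum_i A i) = \sum_i bcirc (A i).
Proof. by apply: big_morph => [x y|]; rewrite ?bcircD ?bcirc0. Qed.

Lemma bcirc_tr m n (A : tubal R l m n) : bcirc (ttr A) = (bcirc A)^T.
Proof.
by rewrite /bcirc tr_mxblock; apply: eq_mxblock => i j; rewrite ffunE opprB.
Qed.

Lemma unfoldM m n p (A : tubal R l m n) (B : tubal R l n p) :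
  unfold (A ** B) = bcirc A *m unfold B.
Proof.
rewrite /bcirc /unfold mul_mxblock_mxrow; apply: eq_mxcol => i.
by rewrite tmulE.
Qed.

Lemma unfoldK m n : cancel (@unfold R l m n) fold.
Proof. by move=> A; apply/ffunP => k; rewrite ffunE mxcolK. Qed.

Lemma foldK m n : cancel (@fold R l m n) unfold.
Proof.
move=> U; rewrite /unfold -[RHS]submxcolK; apply: eq_mxcol => i.
by rewrite ffunE.
Qed.

Lemma bcirc1 n : bcirc (tid n : tubal R l n n) = 1%:M.
Proof.
by rewrite -[LHS]mulmx1 -[X in _ *m X]foldK -unfoldM tmul1l foldK.
Qed.

Lemma bcircX n (A : tubal R l n n) k :
  bcirc (iter k (tmul A) (tid n)) = bcirc A ^+ k.
Proof. by elim: k => [|k IH]; rewrite /= ?bcirc1 // bcircM IH exprS. Qed.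

Lemma tdotC m n (X Y : tubal R l m n) : tdot X Y = tdot Y X.
Proof.
apply: eq_bigr => k _; apply: eq_bigr => i _; apply: eq_bigr => j _.
exact: mulrC.
Qed.

Lemma tdot_trace m n (X Y : tubal R l m n) :
  tdot X Y = \sum_k \tr ((X k)^T *m Y k).
Proof.
apply: eq_bigr => k _; rewrite exchange_big; apply: eq_bigr => i _ /=.
by rewrite mxE; apply: eq_bigr => j _; rewrite mxE.
Qed.

Lemma tdotDl m n (X Y Z : tubal R l m n) : tdot (X + Y) Z = tdot X Z + tdot Y Z.
Proof.
rewrite !tdot_trace -big_split; apply: eq_bigr => k _ /=.
by rewrite ffunE linearD mulmxDl linearD.
Qed.

Lemma tdotZl m n a (X Z : tubal R l m n) : tdot (a *: X) Z = a * tdot X Z.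
Proof.
rewrite !tdot_trace mulr_sumr; apply: eq_bigr => k _ /=.
by rewrite ffunE linearZ /= -scalemxAl linearZ.
Qed.

Lemma tdotBl m n (X Y Z : tubal R l m n) : tdot (X - Y) Z = tdot X Z - tdot Y Z.
Proof. by rewrite -(scaleN1r Y) tdotDl tdotZl mulN1r. Qed.

Lemma tdotBr m n (X Y Z : tubal R l m n) : tdot X (Y - Z) = tdot X Y - tdot X Z.
Proof. by rewrite !(tdotC X) tdotBl. Qed.

Lemma tdot0l m n (Z : tubal R l m n) : tdot 0 Z = 0.
Proof. by have := tdotZl 0 Z Z; rewrite scale0r mul0r. Qed.

Lemma tdot_suml m n (I : finType) (X : I -> tubal R l m n) Z :
  tdot (\sum_i X i) Z = \sum_i tdot (X i) Z.
Proof. by apply: (big_morph (tdot^~ Z)) => [x y|]; rewrite ?tdotDl ?tdot0l. Qed.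

Lemma tdot_ge0 m n (X : tubal R l m n) : 0 <= tdot X X.
Proof. by do 3 (rewrite sumr_ge0 // => ? _); rewrite -expr2 sqr_ge0. Qed.

Lemma tdot_eq0 m n (X : tubal R l m n) : (tdot X X == 0) = (X == 0).
Proof.
apply/idP/eqP => [|->]; last by rewrite tdot0l.
rewrite psumr_eq0 => [/allP h|k _]; last first.
  by do 2 (rewrite sumr_ge0 // => ? _); rewrite -expr2 sqr_ge0.
apply/ffunP => k; apply/matrixP => i j; rewrite ffunE mxE.
have := h k (mem_index_enum _).
rewrite psumr_eq0 /= => [/allP h1|? _]; last first.
  by rewrite sumr_ge0 // => ? _; rewrite -expr2 sqr_ge0.
have := h1 i (mem_index_enum _).
rewrite psumr_eq0 /= => [/allP h2|? _]; last first.
  by rewrite -expr2 sqr_ge0.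
by have := h2 j (mem_index_enum _); rewrite /= mulf_eq0 orbb => /eqP.
Qed.

Lemma tdot_gt0 m n (X : tubal R l m n) : X != 0 -> 0 < tdot X X.
Proof. by move=> X0; rewrite lt_def tdot_eq0 X0 tdot_ge0. Qed.

Lemma tdot_ttr m n (X Y : tubal R l m n) : tdot (ttr X) (ttr Y) = tdot X Y.
Proof.
rewrite /tdot (reindex_inj oppr_inj); apply: eq_bigr => k _.
rewrite exchange_big; apply: eq_bigr => i _; apply: eq_bigr => j _ /=.
by rewrite !ffunE !mxE opprK.
Qed.

Lemma tdotMl m n p (A : tubal R l m n) (X : tubal R l n p) Y :
  tdot (A ** X) Y = tdot X (ttr A ** Y).
Proof.
rewrite !tdot_trace.
under eq_bigr => k _ do rewrite tmulE linear_sum mulmx_suml linear_sum.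
rewrite exchange_big; apply: eq_bigr => q _ /=.
rewrite tmulE mulmx_sumr linear_sum; apply: eq_bigr => k _ /=.
by rewrite trmx_mul ffunE opprB mulmxA.
Qed.

Lemma tdotMr m n p (X : tubal R l m n) (B : tubal R l n p) Y :
  tdot (X ** B) Y = tdot X (Y ** ttr B).
Proof. by rewrite -tdot_ttr ttrM tdotMl -tdot_ttr !ttrM !ttrK. Qed.

Lemma tdot_unfold n (X Y : tubal R l n 1) :
  tdot X Y = bform 1%:M (unfold X)^T (unfold Y)^T.
Proof.
rewrite /bform mulmx1 trmxK /unfold tr_mxcol mul_mxrow_mxcol summxE tdot_trace.
by apply: eq_bigr => k _; rewrite /mxtrace big_ord1.
Qed.

Lemma tdot_bform n (A : tubal R l n n) (X Y : tubal R l n 1) :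
  tdot X (A ** Y) = bform (bcirc A) (unfold X)^T (unfold Y)^T.
Proof.
by rewrite tdot_unfold unfoldM /bform mulmx1 !trmxK mulmxA.
Qed.

Lemma tubal_col_ext m n (A B : tubal R l m n) :
  (forall X : tubal R l n 1, A ** X = B ** X) -> A = B.
Proof.
move=> h; apply/ffunP => k; apply/matrixP => i j.
(* Column [j] of the identity tubal matrix. *)
pose D : tubal R l n 1 := [ffun q => if q == 0 then delta_mx j 0 else 0].
have E (C : tubal R l m n) : (C ** D) k = col j (C k).
  rewrite tmulE (bigD1 0) //= subr0 ffunE eqxx -colE big1 ?addr0 // => q q0.
  by rewrite ffunE (negPf q0) mulmx0.
by have /ffunP/(_ k) := h D; rewrite !E => /matrixP/(_ i 0); rewrite !mxE.
Qed.

(** Yields the symmetry of Kronecker products from that of two-sided multiplications, with no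
    computation on slices. *)
Lemma tubal_selfadjoint n (A : tubal R l n n) :
  (forall X Y : tubal R l n 1, tdot (A ** X) Y = tdot X (A ** Y)) -> ttr A = A.
Proof.
move=> h; apply: tubal_col_ext => X; apply/eqP; rewrite -subr_eq0 -tdot_eq0.
by set Z := _ - _; rewrite {1}/Z tdotBl tdotMl ttrK h subrr.
Qed.

End TubalAlgebra.

(** * Functional calculus: inverses, Moore-Penrose inverses and square roots *)

Section TubalCalculus.
Context {R : realType} {l : nat}.

Definition teval {n} (p : {poly R}) (K : tubal R l n n) : tubal R l n n :=
  \sum_(k < size p) p`_k *: iter k (tmul K) (tid n).

Lemma bcirc_teval n (p : {poly R}) (K : tubal R l n n) :
  bcirc (teval p K) = mxeval p (bcirc K).
Proof.
by rewrite bcirc_sum; apply: eq_bigr => k _; rewrite bcircZ bcircX.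
Qed.

(** [Phi f] evaluates at [K] a polynomial interpolating [f] on the spectrum of [bcirc K]; being a
    polynomial in [K], it is again a tubal matrix. Identities between functions on the spectrum thus
    become identities for the t-product. *)
Lemma tubal_calculus n (K : tubal R l n n) : ttr K = K ->
  exists (s : seq R) (Phi : (R -> R) -> tubal R l n n),
    (forall a, a \in s -> eigenvalue (bcirc K) a) /\
    [/\ Phi (fun=> 1) = tid n, Phi id = K,
        forall f g, Phi (fun a => f a * g a) = Phi f ** Phi g,
        forall f, ttr (Phi f) = Phi f &
        forall f g, {in s, f =1 g} -> Phi f = Phi g].
Proof.
move=> hK; have [|s hs ev] := @sym_spectrum _ _ (bcirc K).
  by rewrite -bcirc_tr hK.
pose p f := sval (cid (interpolation s f)).
have pE f : {in s, forall a, (p f).[a] = f a}.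
  exact: (svalP (cid (interpolation s f))).
exists s, (fun f => teval (p f) K); split=> //; split.
- apply: bcirc_inj; rewrite bcirc_teval bcirc1 -[RHS](mxeval1 (bcirc K)).
  by apply: ev => a /pE ->; rewrite hornerC.
- apply: bcirc_inj; rewrite bcirc_teval -[RHS]mxevalX.
  by apply: ev => a /pE ->; rewrite hornerX.
- move=> f g; apply: bcirc_inj; rewrite bcircM !bcirc_teval -mxevalM.
  by apply: ev => a as_; rewrite hornerM !pE.
- move=> f; apply: bcirc_inj; rewrite bcirc_tr !bcirc_teval mxeval_sym //.
  by rewrite -bcirc_tr hK.
- move=> f g fg; apply: bcirc_inj; rewrite !bcirc_teval.
  by apply: ev => a as_; rewrite !pE // fg.
Qed.

Lemma tinv_unique n (M X : tubal R l n n) :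
  M ** X = tid n -> X ** M = tid n -> tinv M = X.
Proof.
move=> MX XM; apply: xget_unique => // Y [MY YM].
by rewrite -[Y]tmul1r -MX tmulA YM tmul1l.
Qed.

Lemma posdef_eigenvalue_gt0 n (M : tubal R l n n) a :
  tsym_posdef M -> eigenvalue (bcirc M) a -> 0 < a.
Proof.
move=> [_ pM] /eigenvalueP[x xM x0]; pose X : tubal R l n 1 := fold x^T.
have X0 : X != 0.
  apply: contra x0 => /eqP X0; rewrite -(trmxK x) -(foldK x^T) -/X X0.
  apply/eqP; apply/rowP => i; rewrite !mxE ffunE mxE //.
have := pM X X0; rewrite tdot_bform foldK trmxK /bform xM -scalemxAl mxE.
rewrite pmulr_lgt0 //.
have := bform1_ge0 x; rewrite le_eqVlt eq_sym bform1_eq0 (negPf x0) /=.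
by rewrite /bform mulmx1.
Qed.

Lemma tinv_posdef n (M : tubal R l n n) : tsym_posdef M ->
  [/\ M ** tinv M = tid n, tinv M ** M = tid n & ttr (tinv M) = tinv M].
Proof.
move=> pM; have [sM _] := pM.
have [s [Phi [hs [h1 hid hM hsym hE]]]] := tubal_calculus sM.
have e1 : M ** Phi GRing.inv = tid n.
  rewrite -hid -hM -h1; apply: hE => a /hs/(posdef_eigenvalue_gt0 pM) a0.
  by rewrite mulfV // gt_eqF.
have e2 : Phi GRing.inv ** M = tid n.
  rewrite -hid -hM -h1; apply: hE => a /hs/(posdef_eigenvalue_gt0 pM) a0.
  by rewrite mulVf // gt_eqF.
by rewrite (tinv_unique e1 e2).
Qed.

(** The scalar convention [0^-1 = 0] makes [Phi GRing.inv] a Moore-Penrose inverse: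
    [a * a^-1 * a = a] holds at 0 too. *)
Lemma tpinv_sym n (K : tubal R l n n) : ttr K = K ->
  ttr (tpinv K) = tpinv K /\ tpinv K ** K ** tpinv K = tpinv K.
Proof.
move=> sK; have [s [Phi [hs [h1 hid hM hsym hE]]]] := tubal_calculus sK.
pose Y := Phi GRing.inv.
have KY : K ** Y = Phi (fun a => a * a^-1) by rewrite hM hid.
have YK : Y ** K = Phi (fun a => a^-1 * a) by rewrite hM hid.
have KYK : K ** Y ** K = K.
  rewrite KY -[in X in _ ** X]hid -hM -[RHS]hid; apply: hE => a _.
  have [->|a0] := eqVneq a 0; first by rewrite mulr0.
  by rewrite divfK.
have YKY : Y ** K ** Y = Y.
  rewrite YK -hM; apply: hE => a _.
  have [->|a0] := eqVneq a 0; first by rewrite mulr0 mul0r invr0.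
  by rewrite mulVf // mul1r.
suff -> : tpinv K = Y by split; rewrite ?hsym.
apply: xget_unique; first by split=> //; rewrite ?KY ?YK hsym.
move=> X [KXK XKX sKX sXK].
have sKY : ttr (K ** Y) = K ** Y by rewrite KY hsym.
have sYK : ttr (Y ** K) = Y ** K by rewrite YK hsym.
(* Transposing [h] gives [K ** Y = K ** Y ** (K ** X) = K ** X]: symmetric projectors with the same
   range coincide. *)
have eK : K ** X = K ** Y.
  have h : K ** X ** (K ** Y) = K ** Y by rewrite tmulA KXK.
  by rewrite -[RHS]sKY -h ttrM sKX sKY tmulA KYK.
have eX : X ** K = Y ** K.
  have h : Y ** K ** (X ** K) = Y ** K by rewrite -tmulA (tmulA K) KXK.
  by rewrite -[RHS]sYK -h ttrM sXK sYK -tmulA (tmulA K) KYK.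
by rewrite -XKX eX -tmulA eK tmulA.
Qed.

(* A positive semidefinite Q is a polynomial in Q^2, so a square root of a block
   circulant matrix is block circulant as well. *)
Lemma mx_sqrt_bcirc n (M : tubal R l n n) : tsym_posdef M ->
  [/\ (mx_sqrt (bcirc M))^T = mx_sqrt (bcirc M),
      mx_sqrt (bcirc M) *m mx_sqrt (bcirc M) = bcirc M &
      exists Q : tubal R l n n, bcirc Q = mx_sqrt (bcirc M)].
Proof.
move=> pM; have [sM _] := pM.
have [s [Phi [hs [h1 hid hM hsym hE]]]] := tubal_calculus sM.
(* The fourth root: it exhibits [Phi Num.sqrt] as the square of a symmetric element, hence as
   positive semidefinite. *)
pose r2 (a : R) := Num.sqrt (Num.sqrt a).
have [] : mx_psd (mx_sqrt (bcirc M)) /\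
    mx_sqrt (bcirc M) *m mx_sqrt (bcirc M) = bcirc M.
  apply: (@xgetPex _ 0 [set Q | mx_psd Q /\ Q *m Q = bcirc M]).
  exists (bcirc (Phi Num.sqrt)); split; last first.
    rewrite -bcircM -hM -[in RHS]hid; congr bcirc; apply: hE => a.
    by move=> /hs/(posdef_eigenvalue_gt0 pM) a0; rewrite -expr2 sqr_sqrtr // ltW.
  split; first by rewrite -bcirc_tr hsym.
  move=> x; have -> : Phi Num.sqrt = Phi r2 ** Phi r2.
    rewrite -hM; apply: hE => a _.
    by rewrite -expr2 sqr_sqrtr // sqrtr_ge0.
  have := bform1_ge0 (x^T *m bcirc (Phi r2)).
  by rewrite /bform mulmx1 trmx_mul trmxK -bcirc_tr hsym bcircM !mulmxA.
set Q := mx_sqrt _ => -[sQ pQ] QQ; split=> //.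
have [t ht ev] := sym_spectrum sQ.
(* The eigenvalues of [Q] are nonnegative, so [p] recovers each of them from its square, and
   evaluating [p] at [bcirc M] gives [Q]. *)
have [p hp] := interpolation [seq a ^+ 2 | a <- t] Num.sqrt.
exists (teval p M); rewrite bcirc_teval -QQ -mxeval_comp_sqr -[RHS]mxevalX.
apply: ev => a at_; rewrite horner_comp hornerXn hp; last by apply/mapP; exists a.
rewrite sqrtr_sqr hornerX ger0_norm //.
apply: psd_eigenvalue_ge0 (ht _ at_) => x.
by have := pQ x^T; rewrite trmxK.
Qed.

Lemma tsqrt_posdef n (M : tubal R l n n) : tsym_posdef M ->
  ttr (tsqrt M) = tsqrt M /\ tsqrt M ** tsqrt M = M.
Proof.
move=> pM; have [sQ QQ [Q0 hQ0]] := mx_sqrt_bcirc pM.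
have e : bcirc (tsqrt M) = mx_sqrt (bcirc M).
  by apply: (@xgetPex _ 0 [set X | bcirc X = mx_sqrt (bcirc M)]); exists Q0.
by split; apply: bcirc_inj; rewrite ?bcirc_tr ?bcircM e.
Qed.

Lemma tinvsqrt_posdef n (M : tubal R l n n) : tsym_posdef M ->
  [/\ ttr (tinvsqrt M) = tinvsqrt M, tinvsqrt M ** tinvsqrt M = tinv M,
      tsqrt M ** tinvsqrt M = tid n & tinvsqrt M ** tsqrt M = tid n].
Proof.
move=> pM; have [MV VM sV] := tinv_posdef pM; have [sQ QQ] := tsqrt_posdef pM.
(* The inverse of [tsqrt M] will be [tinv M ** tsqrt M], two-sided because the factors commute. *)
have QV : tsqrt M ** tinv M = tinv M ** tsqrt M.
  have h : M ** (tsqrt M ** tinv M) = tsqrt M.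
    rewrite -[X in X ** (_ ** _)]QQ -tmulA.
    rewrite (tmulA (tsqrt M) (tsqrt M) (tinv M)) QQ MV.
    exact: tmul1r.
  by rewrite -[LHS]tmul1l -VM -tmulA h.
have e1 : tsqrt M ** (tinv M ** tsqrt M) = tid n by rewrite -QV tmulA QQ MV.
have e2 : tinv M ** tsqrt M ** tsqrt M = tid n by rewrite -tmulA QQ VM.
rewrite /tinvsqrt (tinv_unique e1 e2) e1 e2; split=> //.
  by rewrite ttrM sV sQ QV.
by rewrite -tmulA e1 tmul1r.
Qed.

End TubalCalculus.

(** * Vectorization and Kronecker products *)

Section TubalKronecker.
Context {R : realType} {l : nat}.

Lemma submxblockZ m n (p : 'I_m -> nat) (q : 'I_n -> nat) (a : R)
    (U : 'M[R]_(\sum_i p i, \sum_j q j)) i j :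
  submxblock (a *: U) i j = a *: submxblock U i j.
Proof. by apply/matrixP => u v; rewrite !mxE. Qed.

Lemma tkron_slice m n p q (A : tubal R l m n) (B : tubal R l p q) k :
  tkron A B k = \mxblock_(i < m, j < n) \sum_e A (k - e) i j *: B e.
Proof.
rewrite ffunE; apply: eq_mxblock => i j; apply/matrixP => u v.
rewrite mxE tmulE !summxE; apply: eq_bigr => e _.
by rewrite !ffunE -scalar_mxM !mxE eqxx mulr1n.
Qed.

(** The tubal form of the identity expressing vec(AXB) through the Kronecker product of the
    transpose of B with A. Tubes commute under the t-product, so [B] only has its row and column
    indices exchanged, with no reversal of slices: hence [tst] and not [ttr]. *)
Lemma tkron_vect m n p q (A : tubal R l p m) (B : tubal R l n q)
    (X : tubal R l m n) :
  tkron (tst B) A ** vect X = vect (A ** X ** B).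
Proof.
have colM m' n' p' (P : 'M[R]_(m', n')) (Q : 'M[R]_(n', p')) i :
    col i (P *m Q) = \sum_j Q j i *: col j P.
  apply/colP => u; rewrite !mxE summxE; apply: eq_bigr => j _.
  by rewrite !mxE mulrC.
have col_sum m' n' (I : finType) (F : I -> 'M[R]_(m', n')) j :
    col j (\sum_e F e) = \sum_e col j (F e).
  by apply/colP => u; rewrite mxE !summxE; apply: eq_bigr => e _; rewrite mxE.
apply/ffunP => k; rewrite tmulE [RHS]ffunE.
have slice e : tkron (tst B) A (k - e) *m vect X e =
    \mxcol_i \sum_j (\sum_f tst B (k - e - f) i j *: A f) *m col j (X e).
  by rewrite tkron_slice ffunE mul_mxblock_mxrow.
rewrite (eq_bigr _ (fun e _ => slice e)) -mxcol_sum; apply: eq_mxcol => i.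
rewrite [in RHS]tmulE col_sum.
under [RHS]eq_bigr => b _ do rewrite colM.
rewrite exchange_big [RHS]exchange_big; apply: eq_bigr => j _ /=.
(* The substitution puts [tst B] at the summation index, so that the sum over [e] becomes a slice of
   [A ** X]. *)
under eq_bigr => e _ do
  rewrite mulmx_suml (reindex_inj (can_inj (subKr (k - e)))).
rewrite exchange_big; apply: eq_bigr => b _ /=.
rewrite tmulE col_sum scaler_sumr; apply: eq_bigr => e _.
by rewrite subKr ffunE mxE -scalemxAl colE mulmxA -colE addrAC.
Qed.

Lemma vect_inj m n : injective (@vect R l m n).
Proof.
move=> X Y h; apply/ffunP => k; apply/matrixP => i j.
have /ffunP/(_ k) := h; rewrite !ffunE => /eq_mxcolP/(_ j)/colP/(_ i).
by rewrite !mxE.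
Qed.

Lemma vect_surj m n (Y : tubal R l (\sum_(j < n) m) 1) :
  exists X : tubal R l m n, vect X = Y.
Proof.
exists [ffun k => \matrix_(i, j) submxcol (Y k) j i 0].
apply/ffunP => k; rewrite ffunE -[RHS]submxcolK; apply: eq_mxcol => j.
by apply/colP => i; rewrite mxE ffunE mxE.
Qed.

Lemma vectB m n (X Y : tubal R l m n) : vect (X - Y) = vect X - vect Y.
Proof.
apply/ffunP => k; rewrite !ffunE -mxcolB; apply: eq_mxcol => j.
by rewrite linearB.
Qed.

Lemma vectZ m n a (X : tubal R l m n) : vect (a *: X) = a *: vect X.
Proof.
apply/ffunP => k; rewrite !ffunE; apply/matrixP => i j.
by rewrite !mxE.
Qed.

Lemma vect0 m n : vect (0 : tubal R l m n) = 0.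
Proof. by have := vectZ 0 (0 : tubal R l m n); rewrite !scale0r. Qed.

Lemma vect_eq0 m n (X : tubal R l m n) : (vect X == 0) = (X == 0).
Proof. by rewrite -vect0 (inj_eq (@vect_inj _ _)). Qed.

Lemma tdot_vect m n (X Y : tubal R l m n) : tdot (vect X) (vect Y) = tdot X Y.
Proof.
rewrite !tdot_trace; apply: eq_bigr => k _; rewrite !ffunE tr_mxcol.
rewrite mul_mxrow_mxcol linear_sum; apply: eq_bigr => j _ /=.
by rewrite /mxtrace big_ord1 !mxE; apply: eq_bigr => i _; rewrite !mxE.
Qed.

(** Every column is some [vect X], on which both sides are the same composite of two-sided
    multiplications. *)
Lemma tkronM m n p q u v (A : tubal R l m n) (B : tubal R l p q)
    (C : tubal R l n u) (D : tubal R l q v) :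
  tkron A B ** tkron C D = tkron (A ** C) (B ** D).
Proof.
apply: tubal_col_ext => Y; have [X <-] := vect_surj Y.
rewrite -tmulA -(tstK A) -(tstK C) -tstM !tkron_vect.
by rewrite !tmulA.
Qed.

Lemma tkron1 m n : tkron (tid m : tubal R l m m) (tid n : tubal R l n n) = tid _.
Proof.
apply: tubal_col_ext => Y; have [X <-] := vect_surj Y.
by rewrite -(tst1 m) tkron_vect !tmul1l tmul1r.
Qed.

Lemma tkronDl m n p q (A B : tubal R l m n) (C : tubal R l p q) :
  tkron (A + B) C = tkron A C + tkron B C.
Proof.
apply/ffunP => k; rewrite [RHS]ffunE !tkron_slice -mxblockD.
apply: eq_mxblock => i j; rewrite -big_split; apply: eq_bigr => e _.
by rewrite ffunE mxE scalerDl.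
Qed.

Lemma tkronDr m n p q (A : tubal R l m n) (B C : tubal R l p q) :
  tkron A (B + C) = tkron A B + tkron A C.
Proof.
apply/ffunP => k; rewrite [RHS]ffunE !tkron_slice -mxblockD.
apply: eq_mxblock => i j; rewrite -big_split; apply: eq_bigr => e _.
by rewrite ffunE scalerDr.
Qed.

Lemma tkronZl m n p q a (A : tubal R l m n) (C : tubal R l p q) :
  tkron (a *: A) C = a *: tkron A C.
Proof.
apply/ffunP => k; rewrite [RHS]ffunE !tkron_slice -[RHS]submxblockK.
apply: eq_mxblock => i j; rewrite submxblockZ mxblockK scaler_sumr.
by apply: eq_bigr => e _; rewrite ffunE mxE scalerA.
Qed.

Lemma tkronZr m n p q a (A : tubal R l m n) (C : tubal R l p q) :
  tkron A (a *: C) = a *: tkron A C.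
Proof.
apply/ffunP => k; rewrite [RHS]ffunE !tkron_slice -[RHS]submxblockK.
apply: eq_mxblock => i j; rewrite submxblockZ mxblockK scaler_sumr.
by apply: eq_bigr => e _; rewrite ffunE !scalerA mulrC.
Qed.

(** Bilinearity: the mean over independent [i] and [j] factors into separate means. *)
Lemma tkron_mean p m n q s t (pS : 'I_p -> R) (pV : 'I_q -> R)
    (Z : 'I_p -> tubal R l m n) (W : 'I_q -> tubal R l s t) :
  mean pS (fun i => mean pV (fun j => bcirc (tkron (W j) (Z i)))) =
  bcirc (tkron (mean pV W) (mean pS Z)).
Proof.
have tkron0l C : tkron 0 C = 0 :> tubal R l (\sum_(i < s) m) (\sum_(j < t) n).
  by have := tkronZl 0 (0 : tubal R l s t) C; rewrite !scale0r.
have tkron0r C : tkron C 0 = 0 :> tubal R l (\sum_(i < s) m) (\sum_(j < t) n).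
  by have := tkronZr 0 C (0 : tubal R l m n); rewrite !scale0r.
rewrite /mean (big_morph (tkron _) (tkronDr _) (tkron0r _)) bcirc_sum.
apply: eq_bigr => i _; rewrite tkronZr bcircZ; congr (_ *: _).
rewrite (big_morph (tkron^~ _) (fun A B => tkronDl A B _) (tkron0l _)) bcirc_sum.
by apply: eq_bigr => j _; rewrite tkronZl bcircZ.
Qed.

Lemma iter_tkron m n (W : tubal R l m m) (Z : tubal R l n n) k :
  iter k (tmul (tkron W Z)) (tid _) =
  tkron (iter k (tmul W) (tid _)) (iter k (tmul Z) (tid _)).
Proof. by elim: k => [|k IH] /=; rewrite ?tkron1 // IH tkronM. Qed.

Lemma iter_tst m (W : tubal R l m m) k :
  iter k (tmul (tst W)) (tid _) = tst (iter k (tmul W) (tid _)).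
Proof.
elim: k => [|k IH]; first by rewrite /= tst1.
rewrite /= IH -tstM; congr tst.
by elim: k {IH} => [|k IH] /=; rewrite ?tmul1l ?tmul1r // -tmulA IH.
Qed.

Lemma teval_tkron_block m n (W : tubal R l m m) (Z : tubal R l n n) p k i j :
  submxblock (teval p (tkron W Z) k) i j =
  \sum_(c < size p) p`_c *: \sum_e
    iter c (tmul W) (tid m) (k - e) i j *: iter c (tmul Z) (tid n) e.
Proof.
rewrite /teval sum_ffunE submxblock_sum; apply: eq_bigr => c _.
by rewrite ffunE submxblockZ iter_tkron tkron_slice mxblockK.
Qed.

(* A polynomial in W (x) Z has (i, j) block sum_k c_k (W^k)_ij * Z^k, which only
   trades places with the (j, i) block when W is transposed. *)
Lemma eigenvalue_tkron_tst m n (W : tubal R l m m) (Z : tubal R l n n) a :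
  eigenvalue (bcirc (tkron (tst W) Z)) a = eigenvalue (bcirc (tkron W Z)) a.
Proof.
have key (W' : tubal R l m m) p : mxeval p (bcirc (tkron W' Z)) = 0 ->
    mxeval p (bcirc (tkron (tst W') Z)) = 0.
  rewrite -!bcirc_teval -(bcirc0 _ _) => /bcirc_inj h; congr bcirc.
  apply/ffunP => k; apply/mxblockP => i j.
  have := teval_tkron_block W' Z p k j i; rewrite h => e.
  apply: etrans (teval_tkron_block _ _ _ _ _ _) _.
  apply: etrans (etrans _ (esym e)) _.
    apply: eq_bigr => c _; congr (_ *: _).
    by apply: eq_bigr => f _; rewrite iter_tst ffunE mxE.
  by apply/matrixP => u v; rewrite !mxE !ffunE !mxE.
apply/idP/idP; first by apply: eigenvalue_transfer => p; apply: key.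
by rewrite -{1}(tstK W); apply: eigenvalue_transfer => p; apply: key.
Qed.

End TubalKronecker.

(** * Minimal Rayleigh quotients on the range of a tubal matrix *)

Section TubalRayleigh.
Context {R : realType} {l : nat}.

Lemma minimum_eq (E : set R) a :
  E a -> (forall b, E b -> a <= b) -> minimum E = a.
Proof.
move=> Ea lea; apply: xget_unique => // b [Eb leb].
by apply/le_anti; rewrite lea // leb.
Qed.

Lemma minimum_set0 (E : set R) : (forall a, ~ E a) -> minimum E = 0.
Proof. by move=> E0; apply: xgetPN => a [/E0]. Qed.

(** Unfolding identifies [trange C] with the row space of the transpose of [bcirc C]. The identity
    as [C] serves [lambda], the matrix defining [ntesp_range] serves [delta2]. *)
Lemma tubal_rayleigh n p (C : tubal R l n p) (H G : tubal R l n n) :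
  ttr H = H -> tsym_posdef G -> (exists2 Y, trange C Y & Y != 0) ->
  exists (mu : R) (Y0 : tubal R l n 1), [/\ trange C Y0, Y0 != 0,
    forall Y, trange C Y -> tdot Y0 (H ** Y) = mu * tdot Y0 (G ** Y) &
    forall Y, trange C Y -> mu * tdot Y (G ** Y) <= tdot Y (H ** Y)].
Proof.
move=> sH [sG pG] [_ [X _ <-] CX0].
have inC (Y : tubal R l n 1) : trange C Y -> ((unfold Y)^T <= (bcirc C)^T)%MS.
  by move=> [Z _ <-]; rewrite unfoldM trmx_mul submxMl.
have K0 : (bcirc C)^T != 0.
  apply: contra CX0 => /eqP K0; rewrite -(unfoldK (C ** X)) unfoldM.
  rewrite -(trmxK (bcirc C)) K0 trmx0 mul0mx; apply/eqP/ffunP => k.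
  by apply/matrixP => i j; rewrite !ffunE !mxE.
have [||x x0|mu [x [x0 /submxP[z xz] hx hmu]]] :=
    @rayleigh_subspace _ _ _ _ (bcirc H) (bcirc G) K0.
- by rewrite -bcirc_tr sH.
- by rewrite -bcirc_tr sG.
- have := pG (fold x^T); rewrite tdot_bform foldK trmxK; apply.
  apply: contra x0 => /eqP e; rewrite -(trmxK x) -(foldK x^T) e.
  by apply/eqP/rowP => i; rewrite !mxE ffunE mxE.
have xE : x = (unfold (C ** fold z^T))^T by rewrite unfoldM foldK trmx_mul trmxK.
exists mu, (C ** fold z^T); split.
- by exists (fold z^T).
- apply: contra x0 => /eqP e; rewrite xE e.
  by apply/eqP/rowP => i; rewrite !mxE ffunE mxE.
- by move=> Y /inC/hx; rewrite !tdot_bform -xE.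
- by move=> Y /inC/hmu; rewrite !tdot_bform.
Qed.

End TubalRayleigh.

(** * Orthogonal projectors for the t-product *)

Section Projectors.
Context {R : realType} {l : nat}.

Definition projector {n} (Z : tubal R l n n) := ttr Z = Z /\ Z ** Z = Z.

(** The usual formula for the orthogonal projector onto the range of [U]; both [Z i] and [W j] have
    this form. *)
Lemma projector_tpinv m n (U : tubal R l m n) :
  projector (U ** tpinv (ttr U ** U) ** ttr U).
Proof.
have [|sX XKX] := @tpinv_sym _ _ _ (ttr U ** U); first by rewrite ttrM ttrK.
split; first by rewrite !ttrM ttrK sX tmulA.
set X := tpinv _ in sX XKX *.
have -> : U ** X ** ttr U ** (U ** X ** ttr U) =
    U ** (X ** (ttr U ** U) ** X) ** ttr U.
  by rewrite !tmulA.
by rewrite XKX.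
Qed.

(** Since [Z] and [W] act on opposite sides, [D] to [Z ** D ** W] is itself an orthogonal projector,
    and [projector_step] is Pythagoras for it. *)
Lemma projector_dot r s (Z : tubal R l r r) (W : tubal R l s s) D :
  projector Z -> projector W ->
  tdot (Z ** D ** W) (Z ** D ** W) = tdot (Z ** D ** W) D.
Proof.
move=> [sZ ZZ] [sW WW].
rewrite tdotMr sW -(tmulA _ W W) WW -[X in tdot _ X]tmulA tdotMl sZ.
by rewrite !tmulA ZZ tdotC.
Qed.

Lemma projector_step r s (Z : tubal R l r r) (W : tubal R l s s) D :
  projector Z -> projector W ->
  tdot (D - Z ** D ** W) (D - Z ** D ** W) = tdot D D - tdot (Z ** D ** W) D.
Proof.
move=> pZ pW; rewrite tdotBl !tdotBr (projector_dot D pZ pW).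
by rewrite (tdotC D (Z ** _ ** _)) subrr subr0.
Qed.

Lemma projector_le r s (Z : tubal R l r r) (W : tubal R l s s) D :
  projector Z -> projector W ->
  0 <= tdot (Z ** D ** W) D <= tdot D D.
Proof.
move=> pZ pW; rewrite -{1}(projector_dot D pZ pW) tdot_ge0 /=.
by rewrite -subr_ge0 -projector_step // tdot_ge0.
Qed.

End Projectors.

(** * The error of the iteration *)

Section Ntesp.
Context {R : realType} {l m n r s tau zeta qS qV : nat}.
Context (A : tubal R l m r) (B : tubal R l s n).
Context (M : tubal R l r r) (N : tubal R l s s).
Context (S : 'I_qS -> tubal R l m tau) (V : 'I_qV -> tubal R l n zeta).
Context (pS : 'I_qS -> R) (pV : 'I_qV -> R).
Context (hM : tsym_posdef M) (hN : tsym_posdef N).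
Context (hpS : prob_vector pS) (hpV : prob_vector pV).

Local Notation Z := (ntesp_Z A M S).
Local Notation W := (ntesp_W B N V).

Lemma projector_Z i : projector (Z i).
Proof.
have [sM MM _ _] := tinvsqrt_posdef hM.
(* For this [U], the product [ttr U ** U] is the matrix whose pseudoinverse occurs in [ntesp_E]. *)
have := projector_tpinv (tinvsqrt M ** ttr A ** S i).
rewrite !ttrM ttrK sM !tmulA -(tmulA _ (tinvsqrt M) (tinvsqrt M)) MM.
by rewrite /ntesp_Z /ntesp_E !tmulA.
Qed.

Lemma projector_W j : projector (W j).
Proof.
have [sN NN _ _] := tinvsqrt_posdef hN.
have := projector_tpinv (tinvsqrt N ** B ** V j).
rewrite !ttrM sN !tmulA -(tmulA _ (tinvsqrt N) (tinvsqrt N)) NN.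
by rewrite /ntesp_W /ntesp_G !tmulA.
Qed.

Definition scaled (X : tubal R l r s) : tubal R l r s := tsqrt M ** X ** tsqrt N.

Lemma scaledB X Y : scaled (X - Y) = scaled X - scaled Y.
Proof. by rewrite /scaled tmulDr tmulNr tmulDl tmulNl. Qed.

Lemma scaled_eq0 X : (scaled X == 0) = (X == 0).
Proof.
have [_ _ _ MM] := tinvsqrt_posdef hM; have [_ _ NN _] := tinvsqrt_posdef hN.
apply/eqP/eqP => [e|->]; last by rewrite /scaled tmul0r tmul0l.
have : tinvsqrt M ** scaled X ** tinvsqrt N = X.
  by rewrite /scaled !tmulA MM tmul1l -tmulA NN tmul1r.
by rewrite e tmul0r tmul0l => <-.
Qed.

Lemma scaled_surj D : exists X, scaled X = D.
Proof.
have [_ _ MM _] := tinvsqrt_posdef hM; have [_ _ _ NN] := tinvsqrt_posdef hN.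
exists (tinvsqrt M ** D ** tinvsqrt N).
by rewrite /scaled !tmulA MM tmul1l -tmulA NN tmul1r.
Qed.

Lemma sqnormF_scaled X : sqnormF M N X = tdot (scaled X) (scaled X).
Proof.
have [sM MM] := tsqrt_posdef hM; have [sN NN] := tsqrt_posdef hN.
rewrite /sqnormF /sqnorm tkron_vect tdot_vect /scaled [RHS]tdotMr sN.
rewrite -(tmulA _ (tsqrt N) (tsqrt N)) NN [RHS]tdotMl sM !tmulA MM.
exact: tdotC.
Qed.

Lemma sqnormF_gt0 X : X <> 0 -> 0 < sqnormF M N X.
Proof. by move=> /eqP X0; rewrite sqnormF_scaled tdot_gt0 // scaled_eq0. Qed.

(** Here [X] stands for the error: as [A ** Xstar ** B = C], this is the term subtracted in one
    iteration. *)
Definition correction i j X :=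
  tinv M ** ttr A ** ntesp_E A M S i ** (A ** X ** B) ** ntesp_G B N V j
    ** ttr B ** tinv N.

Lemma scaled_correction i j X :
  scaled (correction i j X) = Z i ** scaled X ** W j.
Proof.
have [sM MM MV VM] := tinvsqrt_posdef hM.
have [sN NN NV VN] := tinvsqrt_posdef hN.
rewrite /scaled /correction -MM -NN !tmulA MV tmul1l.
rewrite -(tmulA _ (tinvsqrt N) (tsqrt N)) VN tmul1r /ntesp_Z /ntesp_W !tmulA.
rewrite -(tmulA _ (tinvsqrt M) (tsqrt M)) VM tmul1r.
by rewrite -(tmulA _ (tsqrt N) (tinvsqrt N)) NV tmul1r.
Qed.

Lemma ntesp_rangeP X : ntesp_range A B M N (vect X) <->
  exists Y, X = tinv M ** ttr A ** Y ** ttr B ** tinv N.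
Proof.
(* [trev B] is the slice transpose of [ttr B], so the left factor is [tst (ttr B ** tinv N)], the
   shape that [tkron_vect] expects. *)
have E Y : tkron (tst (tinv N) ** trev B) (tinv M ** ttr A) ** vect Y =
    vect (tinv M ** ttr A ** Y ** ttr B ** tinv N).
  by rewrite trev_tst -tstM tkron_vect !tmulA.
split=> [[Y0 _]|[Y ->]]; last by exists (vect Y); rewrite // E.
have [Y <-] := vect_surj Y0; rewrite E => /vect_inj <-.
by exists Y.
Qed.

Lemma ntesp_range_sub X Y : ntesp_range A B M N (vect X) ->
  ntesp_range A B M N (vect Y) -> ntesp_range A B M N (vect (X - Y)).
Proof.
move=> [X' _ eX] [Y' _ eY]; rewrite vectB -eX -eY; exists (X' - Y') => //.
by rewrite tmulDr tmulNr.
Qed.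

Lemma ntesp_range_correction i j X :
  ntesp_range A B M N (vect (correction i j X)).
Proof.
apply/ntesp_rangeP.
exists (ntesp_E A M S i ** (A ** X ** B) ** ntesp_G B N V j).
by rewrite /correction !tmulA.
Qed.

Definition energy (D : tubal R l r s) : R :=
  tdot (mean pS Z ** D ** mean pV W) D.

Lemma energyE D : energy D =
  \sum_i pS i * \sum_j pV j * tdot (Z i ** D ** W j) D.
Proof.
rewrite /energy /mean tmul_suml tmul_suml tdot_suml; apply: eq_bigr => i _.
rewrite !tmulZl tdotZl; congr (_ * _).
rewrite tmul_sumr tdot_suml; apply: eq_bigr => j _.
by rewrite tmulZr tdotZl.
Qed.

Lemma mean_step X :
  \sum_i pS i * \sum_j pV j * sqnormF M N (X - correction i j X) =
  sqnormF M N X - energy (scaled X).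
Proof.
have [_ S1] := hpS; have [_ V1] := hpV.
have E i j : sqnormF M N (X - correction i j X) =
    sqnormF M N X - tdot (Z i ** scaled X ** W j) (scaled X).
  rewrite !sqnormF_scaled scaledB scaled_correction.
  exact: projector_step (projector_Z i) (projector_W j).
rewrite energyE -[sqnormF M N X in RHS]mul1r -S1 mulr_suml -sumrB.
apply: eq_bigr => i _; rewrite -mulrBr; congr (_ * _).
rewrite -[X in X - _]mul1r -V1 mulr_suml -sumrB.
by apply: eq_bigr => j _; rewrite E mulrBr.
Qed.

(** The upper bound will keep both rates at most 1, so that the contraction factors are
    nonnegative. *)
Lemma energy_bounds D : 0 <= energy D <= tdot D D.
Proof.
have [pS0 S1] := hpS; have [pV0 V1] := hpV; rewrite energyE.
have le i j := projector_le D (projector_Z i) (projector_W j).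
apply/andP; split.
  apply: sumr_ge0 => i _; rewrite mulr_ge0 // sumr_ge0 // => j _.
  by rewrite mulr_ge0 //; case/andP: (le i j).
rewrite -[leRHS]mul1r -S1 mulr_suml ler_sum // => i _.
rewrite ler_wpM2l // -[leRHS]mul1r -V1 mulr_suml ler_sum // => j _.
by rewrite ler_wpM2l //; case/andP: (le i j).
Qed.

Lemma mean_Z_sym : ttr (mean pS Z) = mean pS Z.
Proof.
rewrite ttr_sum; apply: eq_bigr => i _.
by have [sZ _] := projector_Z i; rewrite ttrZ sZ.
Qed.

Lemma mean_W_sym : ttr (mean pV W) = mean pV W.
Proof.
rewrite ttr_sum; apply: eq_bigr => j _.
by have [sW _] := projector_W j; rewrite ttrZ sW.
Qed.

Definition mean_kron := tkron (tst (mean pV W)) (mean pS Z).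

Lemma mean_kron_sym : ttr mean_kron = mean_kron.
Proof.
apply: tubal_selfadjoint => X' Y'.
have [X <-] := vect_surj X'; have [Y <-] := vect_surj Y'.
rewrite !tkron_vect !tdot_vect tdotMr mean_W_sym -tmulA tdotMl mean_Z_sym.
by rewrite !tmulA.
Qed.

Lemma energy_vect X : tdot (vect X) (mean_kron ** vect X) = energy X.
Proof. by rewrite tkron_vect tdot_vect tdotC. Qed.

Lemma posdef_tid k : tsym_posdef (tid k : tubal R l k k).
Proof. by split; [exact: ttr1|move=> X X0; rewrite tmul1l tdot_gt0]. Qed.

Lemma lambda_eq : ntesp_lambda A B M N S V pS pV =
  minimum [set a | eigenvalue (bcirc mean_kron) a].
Proof.
rewrite /ntesp_lambda (tkron_mean pS pV (ntesp_Z A M S) (ntesp_W B N V)).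
rewrite /lambda_min; apply: congr1.
apply/funext => a.
exact: (congr1 is_true (esym (eigenvalue_tkron_tst (mean pV W) (mean pS Z) a))).
Qed.

Local Notation lambda := (ntesp_lambda A B M N S V pS pV).
Local Notation delta2 := (ntesp_delta2 A B M N S V pS pV).

(** On the whole space the minimiser is tested against every vector, its own residual included, so
    it is a true eigenvector. Its quotient [mu] is below every eigenvalue because eigenvectors are
    competitors. *)
Lemma lambda_attained : (exists D : tubal R l r s, D != 0) ->
  (forall D, lambda * tdot D D <= energy D) /\
  exists2 D, D != 0 & energy D = lambda * tdot D D.
Proof.
move=> [D D0].
have [|mu [Y0 [_ Y00 hY hmu]]] :=
  tubal_rayleigh mean_kron_sym (@posdef_tid _) (C := tid (\sum_(j < s) r)).
  by exists (vect D); [exists (vect D) => //; exact: tmul1l|rewrite vect_eq0].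
have all (Y : tubal R l (\sum_(j < s) r) 1) : trange (tid _) Y.
  by exists Y => //; exact: tmul1l.
have row0 x : (unfold x : 'cV[R]_(\sum_(k < l.+1) \sum_(j < s) r)) = 0 -> x = 0.
  move=> e; rewrite -(unfoldK x) e; apply/ffunP => k.
  by apply/matrixP => i j; rewrite !ffunE !mxE.
have eig : mean_kron ** Y0 = mu *: Y0.
  apply/eqP; rewrite -subr_eq0 -tdot_eq0; set U := _ - _.
  rewrite {1}/U tdotBl tdotMl mean_kron_sym (hY _ (all U)) tmul1l tdotZl.
  by rewrite subrr.
have mumin : lambda = mu.
  rewrite lambda_eq; apply: minimum_eq.
    apply/eigenvalueP; exists (unfold Y0)^T.
      rewrite -[bcirc _]trmxK -bcirc_tr mean_kron_sym -trmx_mul -unfoldM eig.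
      by apply/matrixP => i j; rewrite !mxE !ffunE !mxE.
    by apply: contra Y00 => /eqP e; apply/eqP/row0; rewrite -[LHS]trmxK e trmx0.
  move=> a /eigenvalueP[x xP x0].
  have := hmu _ (all (fold x^T)); rewrite tmul1l tdot_bform.
  rewrite tdot_unfold foldK trmxK.
  rewrite {2}/bform xP -scalemxAl mxE -[X in _ <= _ * X]/((x *m x^T) 0 0).
  rewrite -[X in (X *m x^T) 0 0]mulmx1 -/(bform 1%:M x x) ler_pM2r //.
  by rewrite lt_def bform1_eq0 x0 bform1_ge0.
rewrite mumin; split=> [X|].
  by have := hmu _ (all (vect X)); rewrite energy_vect tmul1l tdot_vect.
have [X eX] := vect_surj Y0; exists X; first by rewrite -vect_eq0 eX.
by rewrite -energy_vect eX (hY _ (all _)) tmul1l -eX tdot_vect.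
Qed.

(** In dimension zero there is no eigenvector, and [minimum] returns its default. *)
Lemma lambda_degenerate : (forall D : tubal R l r s, D = 0) -> lambda = 0.
Proof.
move=> all0; rewrite lambda_eq; apply: minimum_set0 => a /eigenvalueP[x _ /eqP[]].
have [X eX] := vect_surj (fold x^T).
rewrite -(trmxK x) -(foldK x^T) -eX (all0 X) vect0.
by apply/rowP => i; rewrite !mxE ffunE mxE.
Qed.

Definition ratio (X : tubal R l r s) : R := energy (scaled X) / sqnormF M N X.

Lemma delta2_eq : delta2 =
  minimum [set ratio X | X in [set X | ntesp_range A B M N (vect X) /\ X <> 0]].
Proof.
rewrite /ntesp_delta2 tst_mean; congr minimum.
have E X : sqnorm (tkron (tst (mean pV W)) (mean pS Z))
      (tkron (tst (tsqrt N)) (tsqrt M) ** vect X)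
      / sqnorm (tkron (tst N) M) (vect X) = ratio X.
  by rewrite tkron_vect /sqnorm tkron_vect tdot_vect.
have v0 X : vect X = 0 <-> X = 0.
  by split=> [/eqP|->]; [rewrite vect_eq0 => /eqP|exact: vect0].
apply/seteqP; split=> a [Y [rY Y0] <-].
  have [X eX] := vect_surj Y; rewrite -eX in rY Y0 *.
  by exists X; [split=> // /v0|rewrite E].
by exists (vect Y); [split=> // /v0|rewrite E].
Qed.

Lemma delta2_attained :
  (exists X, ntesp_range A B M N (vect X) /\ X <> 0) ->
  (forall X, ntesp_range A B M N (vect X) ->
     delta2 * sqnormF M N X <= energy (scaled X)) /\
  exists X, [/\ ntesp_range A B M N (vect X), X <> 0 &
     energy (scaled X) = delta2 * sqnormF M N X].
Proof.
move=> [X1 [rX1 /eqP X10]].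
(* [K] vectorizes [scaled], so conjugating [mean_kron] by it expresses the energy of [scaled X] as a
   quadratic form in [vect X]. *)
pose K := tkron (tst (tsqrt N)) (tsqrt M).
have EH X :
    tdot (vect X) ((ttr K ** mean_kron ** K) ** vect X) = energy (scaled X).
  by rewrite -!tmulA tdotC tdotMl ttrK tdotC -energy_vect tkron_vect.
have EG X : tdot (vect X) (tkron (tst N) M ** vect X) = sqnormF M N X.
  by rewrite tdotC.
have pG : tsym_posdef (tkron (tst N) M).
  split.
    apply: tubal_selfadjoint => X' Y'.
    have [X <-] := vect_surj X'; have [Y <-] := vect_surj Y'.
    rewrite !tkron_vect !tdot_vect tdotMr (proj1 hN) -tmulA tdotMl (proj1 hM).
    by rewrite !tmulA.
  move=> X'; have [X <-] := vect_surj X'.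
  rewrite vect_eq0 EG sqnormF_scaled => X0.
  by rewrite tdot_gt0 // scaled_eq0.
have sH : ttr (ttr K ** mean_kron ** K) = ttr K ** mean_kron ** K.
  by rewrite !ttrM ttrK mean_kron_sym tmulA.
have [|mu [Y0 [rY0 Y00 hY hmu]]] := tubal_rayleigh sH pG
    (C := tkron (tst (tinv N) ** trev B) (tinv M ** ttr A)).
  by exists (vect X1); rewrite ?vect_eq0.
have [X0 eX0] := vect_surj Y0; rewrite -eX0 in rY0 Y00.
have X0n : X0 <> 0 by apply/eqP; rewrite -vect_eq0.
have E0 : energy (scaled X0) = mu * sqnormF M N X0.
  by have := hY _ rY0; rewrite -eX0 EH EG.
have hmu' X : ntesp_range A B M N (vect X) ->
    mu * sqnormF M N X <= energy (scaled X).
  by move=> /hmu; rewrite EH EG.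
suff -> : delta2 = mu by split=> //; exists X0.
rewrite delta2_eq; apply: minimum_eq.
  by exists X0 => //; rewrite /ratio E0 mulfK // gt_eqF // sqnormF_gt0.
by move=> _ [X [rX /sqnormF_gt0 Xp] <-]; rewrite ler_pdivlMr // hmu'.
Qed.

Lemma delta2_degenerate :
  (forall X, ntesp_range A B M N (vect X) -> X = 0) -> delta2 = 0.
Proof.
move=> r0; rewrite delta2_eq; apply: minimum_set0 => a [X [rX X0] _].
exact/X0/r0.
Qed.

(** An attained quotient is at most 1 by [energy_bounds]; in the degenerate case the default 0 is
    still a valid rate, as the energy is nonnegative. The same holds for [delta2_bound]. *)
Lemma lambda_bound :
  lambda <= 1 /\ forall X, lambda * sqnormF M N X <= energy (scaled X).
Proof.
have [h|h] := pselect (exists D : tubal R l r s, D != 0).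
  have [le [D D0 eD]] := lambda_attained h.
  split=> [|X]; last by rewrite sqnormF_scaled.
  have := energy_bounds D; rewrite eD => /andP[_].
  by rewrite -[leRHS]mul1r ler_pM2r // tdot_gt0.
rewrite lambda_degenerate => [|D]; last first.
  by apply/eqP/negPn/negP => D0; apply: h; exists D.
split=> [|X]; first exact: ler01.
by rewrite mul0r; case/andP: (energy_bounds (scaled X)).
Qed.

Lemma delta2_bound : delta2 <= 1 /\
  forall X, ntesp_range A B M N (vect X) ->
    delta2 * sqnormF M N X <= energy (scaled X).
Proof.
have [h|h] := pselect (exists X, ntesp_range A B M N (vect X) /\ X <> 0).
  have [le [X [_ X0 eX]]] := delta2_attained h; split=> //.
  have := energy_bounds (scaled X); rewrite eX -sqnormF_scaled => /andP[_].
  by rewrite -[leRHS]mul1r ler_pM2r // sqnormF_gt0.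
rewrite delta2_degenerate => [|X rX]; last first.
  by apply/eqP/negPn/negP => /eqP X0; apply: h; exists X.
split=> [|X _]; first exact: ler01.
by rewrite mul0r; case/andP: (energy_bounds (scaled X)).
Qed.

Lemma lambda_delta2 :
  ntesp_range A B M N = setT \/ delta2 = 0 -> delta2 = lambda.
Proof.
move=> hyp.
have [hD|hD] := pselect (exists D : tubal R l r s, D != 0); last first.
  have all0 (D : tubal R l r s) : D = 0.
    by apply/eqP/negPn/negP => D0; apply: hD; exists D.
  by rewrite (lambda_degenerate all0) delta2_degenerate // => X _; exact: all0.
have [leL [D D0 eD]] := lambda_attained hD.
have [X eX] := scaled_surj D.
have X0 : X <> 0 by apply/eqP; rewrite -scaled_eq0 eX.
have Xp := sqnormF_gt0 X0.
have eL : energy (scaled X) = lambda * sqnormF M N X by rewrite sqnormF_scaled eX.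
have lambda_le Y : Y <> 0 -> energy (scaled Y) = delta2 * sqnormF M N Y ->
    lambda <= delta2.
  move=> /sqnormF_gt0 Yp eY.
  by rewrite -(ler_pM2r Yp) -eY; apply: (proj2 lambda_bound).
have [h|h] := pselect (exists X, ntesp_range A B M N (vect X) /\ X <> 0).
  have [leD [Y [rY Y0 eY]]] := delta2_attained h.
  apply/le_anti; rewrite (lambda_le Y Y0 eY) andbT.
  case: hyp => [rT|d0].
    by rewrite -(ler_pM2r Xp) -eL leD // rT.
  by rewrite d0 -(pmulr_lge0 _ Xp) -eL; case/andP: (energy_bounds (scaled X)).
(* With a trivial range [delta2] is the default 0. All corrections lie in the range, hence vanish,
   so the energy is identically zero and [lambda] is 0 as well. *)
have r0 Y : ntesp_range A B M N (vect Y) -> Y = 0.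
  by move=> rY; apply/eqP/negPn/negP => /eqP Y0; apply: h; exists Y.
rewrite delta2_degenerate //; apply/esym/eqP.
have : energy (scaled X) = 0.
  rewrite energyE big1 // => i _; rewrite big1 ?mulr0 // => j _.
  rewrite -scaled_correction (r0 _ (ntesp_range_correction i j X)).
  by rewrite /scaled tmul0r tmul0l tdot0l mulr0.
by rewrite eL => /eqP; rewrite mulf_eq0 (gt_eqF Xp) orbF.
Qed.

End Ntesp.

(** * Expectation along the random draws *)

Section RandomIteration.
Context {d : measure_display} {T : measurableType d} {R : realType}.
Context (P : probability T R) {qS qV : nat}.
Context (pS : 'I_qS -> R) (pV : 'I_qV -> R).
Context (is_ : nat -> T -> 'I_qS) (js_ : nat -> T -> 'I_qV).
Context (hdraws : ntesp_draws P pS pV is_ js_).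
Context {E : Type} (step : 'I_qS -> 'I_qV -> E -> E) (x0 : E) (X : nat -> T -> E).
Context (hX0 : forall w, X 0%N w = x0).
Context (hX : forall t w, X t.+1 w = step (is_ t w) (js_ t w) (X t w)).

Local Notation draw_events := (fun k : nat + nat =>
  match k with inl t => events_of (is_ t) | inr t => events_of (js_ t) end).

(** Finite intersections are the events governed by the product rule, and they are stable under
    fixing the draws at one earlier time. The empty one is the whole space. *)
Definition future_event (t : nat) (G : set T) :=
  exists (ks : seq (nat + nat)) (F : nat + nat -> set T),
  [/\ uniq ks, forall k, k \in ks -> draw_events k (F k),
      forall k, k \in ks -> (t <= match k with inl u => u | inr u => u end)%N &
      G = \big[setI/setT]_(k <- ks) F k].

Lemma measurable_draw t i j :
  measurable (is_ t @^-1` [set i] `&` js_ t @^-1` [set j]).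
Proof.
have [lS lV _] := hdraws.
by apply: measurableI; [case: (lS t i)|case: (lV t j)].
Qed.

Lemma future_event_measurable t G : future_event t G -> measurable G.
Proof.
have [lS lV _] := hdraws.
have mS u (U : set 'I_qS) : measurable (is_ u @^-1` U).
  have -> : is_ u @^-1` U = \bigcup_(a in U) (is_ u @^-1` [set a]).
    by apply/seteqP; split=> [w Uw|w [a Ua /= ->]//]; exists (is_ u w).
  by apply: fin_bigcup_measurable => // a _; case: (lS u a).
have mV u (U : set 'I_qV) : measurable (js_ u @^-1` U).
  have -> : js_ u @^-1` U = \bigcup_(a in U) (js_ u @^-1` [set a]).
    by apply/seteqP; split=> [w Uw|w [a Ua /= ->]//]; exists (js_ u w).
  by apply: fin_bigcup_measurable => // a _; case: (lV u a).
move=> [ks [F [_ hF _ ->]]]; rewrite big_seq; apply: bigsetI_measurable => k.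
by move/hF; case: k => u [U _ <-].
Qed.

Lemma future_event_draw t i j G : future_event t.+1 G ->
  future_event t (is_ t @^-1` [set i] `&` (js_ t @^-1` [set j] `&` G)) /\
  (P (is_ t @^-1` [set i] `&` (js_ t @^-1` [set j] `&` G)) =
     (pS i * pV j)%:E * P G)%E.
Proof.
have [lS lV indep] := hdraws.
move=> [ks [F [uks hF hks ->]]].
have nl : inl t \notin ks by apply/negP => /hks; rewrite ltnn.
have nr : inr t \notin ks by apply/negP => /hks; rewrite ltnn.
(* The two indices of time [t] are new, since those of [ks] are later; the product rule for [ks']
   and for [ks] then differ by exactly two factors. *)
pose F' k := if k == inl t then is_ t @^-1` [set i]
  else if k == inr t then js_ t @^-1` [set j] else F k.
have F'E k : k \in ks -> F' k = F k.
  move=> kks; rewrite /F'; case: eqP => [e|_]; first by rewrite -e kks in nl.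
  by case: eqP => [e|_]; first by rewrite -e kks in nr.
pose ks' := [:: inl t, inr t & ks].
have uks' : uniq ks' by rewrite /= inE /= nl nr uks.
have hF' k : k \in ks' -> draw_events k (F' k).
  rewrite !inE => /or3P[/eqP->|/eqP->|kks].
  - by exists [set i]; rewrite // /F' eqxx.
  - by exists [set j]; rewrite // /F' eqxx.
  - by rewrite F'E //; apply: hF.
have -> : is_ t @^-1` [set i] `&` (js_ t @^-1` [set j] `&`
    \big[setI/setT]_(k <- ks) F k) = \big[setI/setT]_(k <- ks') F' k.
  rewrite !big_cons {1 2}/F' !eqxx; congr (_ `&` (_ `&` _)).
  by rewrite big_seq [RHS]big_seq; apply: eq_bigr => k /F'E.
split.
  exists ks', F'; split=> // k; rewrite !inE => /or3P[/eqP->|/eqP->|/hks/ltnW] //.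
rewrite (indep _ _ uks' hF') (indep _ _ uks hF) !big_cons muleA; congr (_ * _)%E.
  by rewrite /F' !eqxx /= (proj2 (lS t i)) (proj2 (lV t j)) EFinM.
by rewrite big_seq [RHS]big_seq; apply: eq_bigr => k /F'E ->.
Qed.

(** [E] carries no sigma-algebra: each iterate depends on finitely many draws with finitely many
    outcomes, so every subset has a measurable preimage. *)
Lemma measurable_iterate t (U : set E) : measurable (X t @^-1` U).
Proof.
elim: t U => [|t IH] U.
  have [Ux0|nUx0] := pselect (U x0).
    have -> : X 0%N @^-1` U = setT by apply/seteqP; split=> w //= _; rewrite hX0.
    exact: measurableT.
  have -> : X 0%N @^-1` U = set0 by apply/seteqP; split=> w //=; rewrite hX0.
  exact: measurable0.
have -> : X t.+1 @^-1` U = \bigcup_(a in [set: 'I_qS * 'I_qV])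
    ((is_ t @^-1` [set a.1] `&` js_ t @^-1` [set a.2]) `&`
      X t @^-1` (step a.1 a.2 @^-1` U)).
  apply/seteqP; split=> w /=.
    by rewrite hX => Uw; exists (is_ t w, js_ t w).
  by move=> [[a b] _ [[/= <- <-]]]; rewrite hX.
apply: fin_bigcup_measurable => // a _.
by apply: measurableI; [exact: measurable_draw|exact: IH].
Qed.

(** The transition operator of the Markov chain; [iter t mean_after g x] is the mean of [g] after
    [t] steps from [x]. *)
Definition mean_after (g : E -> R) (x : E) : R :=
  \sum_i pS i * \sum_j pV j * g (step i j x).

Lemma mean_after_linear (I : finType) (w : I -> R) (g : I -> E -> R) x :
  mean_after (fun y => \sum_a w a * g a y) x = \sum_a w a * mean_after (g a) x.
Proof.
rewrite /mean_after; under eq_bigr => i _.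
  under eq_bigr => j _ do rewrite mulr_sumr.
  rewrite exchange_big mulr_sumr.
  over.
rewrite exchange_big; apply: eq_bigr => a _ /=; rewrite mulr_sumr.
apply: eq_bigr => i _; rewrite [RHS]mulrCA; congr (_ * _).
by rewrite mulr_sumr; apply: eq_bigr => j _; rewrite mulrCA.
Qed.

Lemma iter_mean_after_linear (I : finType) t (w : I -> R) (g : I -> E -> R) x :
  iter t mean_after (fun y => \sum_a w a * g a y) x =
  \sum_a w a * iter t mean_after (g a) x.
Proof.
elim: t x => [//|t IH] x /=; rewrite -mean_after_linear.
by congr mean_after; apply/funext.
Qed.

Lemma mean_after_pair g x : mean_after g x =
  \sum_(a : 'I_qS * 'I_qV) pS a.1 * pV a.2 * g (step a.1 a.2 x).
Proof.
rewrite /mean_after -(pair_bigA _ (fun i j => pS i * pV j * g (step i j x))) /=.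
apply: eq_bigr => i _; rewrite mulr_sumr.
by apply: eq_bigr => j _; rewrite mulrA.
Qed.

(* Integrating over an arbitrary event G of the draws from time t on is what makes
   the induction work: conditioning on the draws at time t only changes G. *)
Lemma integral_iterate t (g : E -> R) G : (forall x, 0 <= g x) ->
  future_event t G ->
  (\int[P]_(w in G) (g (X t w))%:E = (iter t mean_after g x0)%:E * P G)%E.
Proof.
elim: t g G => [|t IH] g G g0 hG.
  have mG := future_event_measurable hG.
  rewrite -integral_cst //; apply: eq_integral => w _; rewrite /= hX0 //.
have mG := future_event_measurable hG.
(* [G] is partitioned by the draws at time [t]; on each piece the last step is a fixed map, and the
   induction hypothesis applies to [g] composed with it. *)
pose F (a : 'I_qS * 'I_qV) :=
  is_ t @^-1` [set a.1] `&` (js_ t @^-1` [set a.2] `&` G).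
have GF : G = \big[setU/set0]_a F a.
  rewrite -bigcup_seq; apply/seteqP; split=> w.
    by move=> Gw; exists (is_ t w, js_ t w); rewrite /= ?mem_index_enum.
  by move=> [a _ [_ []]].
rewrite {1}GF ge0_integral_bigsetU.
- transitivity (\sum_a ((pS a.1 * pV a.2)
      * iter t mean_after (fun x => g (step a.1 a.2 x)) x0)%:E * P G)%E.
    apply: eq_bigr => a _.
    have [hF PF] := future_event_draw a.1 a.2 hG.
    rewrite mulrC EFinM -muleA -PF -(IH (fun x => g (step a.1 a.2 x))) //.
    by apply: eq_integral => w; rewrite inE => -[e1 [e2 _]]; rewrite hX e1 e2.
  have K0 : mean_after g = fun x =>
      \sum_(a : 'I_qS * 'I_qV) pS a.1 * pV a.2 * g (step a.1 a.2 x).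
    by apply/funext => x; rewrite mean_after_pair.
  (* The last step acts innermost on [g], and linearity moves its finite sum out of the [t]
     remaining averages. *)
  rewrite iterSr K0 iter_mean_after_linear.
  have -> : P G = (fine (P G))%:E by rewrite fineK // fin_num_measure.
  rewrite -EFinM mulr_suml -sumEFin; apply: eq_bigr => a _.
  by rewrite EFinM.
- by move=> a; apply: future_event_measurable (proj1 (future_event_draw _ _ hG)).
- exact: index_enum_uniq.
- move=> [a1 a2] [b1 b2] _ _ [w [[/= e1 [e2 _]] [/= e3 [e4 _]]]].
  by rewrite -e1 -e2 -e3 -e4.
- move=> mD U mU; apply: measurableI => //.
  exact: (measurable_iterate t.+1 (fun x => U (g x)%:E)).
- by move=> w _; rewrite lee_fin.
Qed.

Lemma expectation_iterate t (g : E -> R) : (forall x, 0 <= g x) ->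
  ('E_P[fun w => g (X t w)] = (iter t mean_after g x0)%:E)%E.
Proof.
move=> g0; rewrite unlock -[RHS]mule1 -(@probability_setT _ _ _ P).
apply: integral_iterate => //; exists [::], (fun=> setT).
by split=> //; rewrite big_nil.
Qed.

(** [I] is an invariant set of states, so a contraction valid only there can be iterated;
    nonnegative weights make averaging monotone. *)
Lemma iter_mean_after_le (I : set E) (g : E -> R) rho t :
  (forall i, 0 <= pS i) -> (forall j, 0 <= pV j) -> 0 <= rho ->
  (forall i j x, I x -> I (step i j x)) ->
  (forall x, I x -> mean_after g x <= rho * g x) ->
  forall x, I x -> iter t mean_after g x <= rho ^+ t * g x.
Proof.
move=> pS0 pV0 rho0 Istep hg; elim: t => [|t IH] x Ix; first by rewrite mul1r.
apply: le_trans (_ : rho ^+ t * mean_after g x <= _); last first.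
  by rewrite exprSr -mulrA ler_wpM2l ?hg // exprn_ge0.
rewrite /= {1 3}/mean_after mulr_sumr ler_sum // => i _.
rewrite mulrCA ler_wpM2l // mulr_sumr ler_sum // => j _.
by rewrite mulrCA ler_wpM2l // IH //; apply: Istep.
Qed.

End RandomIteration.

(** * Mean convergence at the two rates, and their comparison *)

Theorem theorem3 (R : realType) (l m n r s tau zeta qS qV : nat)
    (A : tubal R l m r) (B : tubal R l s n) (C : tubal R l m n)
    (M : tubal R l r r) (N : tubal R l s s)
    (hM : tsym_posdef M) (hN : tsym_posdef N)
    (S : 'I_qS -> tubal R l m tau) (V : 'I_qV -> tubal R l n zeta)
    (pS : 'I_qS -> R) (pV : 'I_qV -> R)
    (hpS : prob_vector pS) (hpV : prob_vector pV)
    (Xstar : tubal R l r s) (hXstar : A ** Xstar ** B = C)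
    (d : measure_display) (T : measurableType d) (P : probability T R)
    (is_ : nat -> T -> 'I_qS) (js_ : nat -> T -> 'I_qV)
    (hdraws : ntesp_draws P pS pV is_ js_)
    (X0 : tubal R l r s) (hX0 : ntesp_range A B M N (vect X0))
    (X : nat -> T -> tubal R l r s)
    (hXinit : forall w, X 0%N w = X0)
    (hXstep : forall t w,
      X t.+1 w = X t w -
        tinv M ** ttr A ** ntesp_E A M S (is_ t w) ** (A ** X t w ** B - C)
          ** ntesp_G B N V (js_ t w) ** ttr B ** tinv N) :
  let delta2 := ntesp_delta2 A B M N S V pS pV in
  let lambda := ntesp_lambda A B M N S V pS pV in
  let bound (rho : R) := forall t,
    ('E_P[fun w => sqnormF M N (X t w - Xstar)%R]
       <= (rho ^+ t * sqnormF M N (X0 - Xstar))%:E)%E in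
  [/\ bound (1 - lambda),
      ntesp_range A B M N (vect Xstar) -> bound (1 - delta2) &
      ntesp_range A B M N = setT \/ delta2 = 0 -> 1 - delta2 = 1 - lambda].
Proof.
move=> delta2 lambda bound.
pose step i j (D : tubal R l r s) := D - correction A B M N S V i j D.
pose D t w := X t w - Xstar.
have D0 w : D 0%N w = X0 - Xstar by rewrite /D hXinit.
have Dstep t w : D t.+1 w = step (is_ t w) (js_ t w) (D t w).
  have e : A ** D t w ** B = A ** X t w ** B - C.
    by rewrite -hXstar /D tmulDr tmulNr tmulDl tmulNl.
  by rewrite /step /correction e /D hXstep addrAC.
(* One argument serves both rates: the invariant set is everything for [lambda], the errors in the
   range for [delta2]. *)
have contraction (I : set (tubal R l r s)) (rate : R) :
    rate <= 1 -> (forall i j Y, I Y -> I (step i j Y)) -> I (X0 - Xstar) ->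
    (forall Y, I Y ->
       rate * sqnormF M N Y <= energy A B M N S V pS pV (scaled M N Y)) ->
    bound (1 - rate).
  move=> rate1 Istep I0 hrate t.
  rewrite (expectation_iterate hdraws D0 Dstep) ?lee_fin; last first.
    by move=> Y; rewrite sqnormF_scaled // tdot_ge0.
  apply: (iter_mean_after_le (I := I)) => //; rewrite ?subr_ge0 //.
  - by case: hpS.
  - by case: hpV.
  - move=> Y IY; rewrite /mean_after /step mean_step //.
    by rewrite mulrBl mul1r lerB // hrate.
split.
- have [lambda1 hlambda] := lambda_bound A B S V hM hN hpS hpV.
  exact: (contraction setT).
- move=> rXstar; have [delta1 hdelta] := delta2_bound A B S V hM hN hpS hpV.
  (* [X0] and [Xstar] both lie in the range, hence so does the initial error, and each correction
     keeps later errors there. *)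
  apply: (contraction [set Y | ntesp_range A B M N (vect Y)]) => //.
    move=> i j Y rY; apply: ntesp_range_sub => //.
    exact: ntesp_range_correction.
  exact: ntesp_range_sub.
- by move=> /(lambda_delta2 hM hN hpS hpV) e; rewrite /delta2 e.
Qed.
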